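(* There exist universal constants $K,C>0$ and a randomized first-order method with the following property. Consider any finite-sum problem $\min_x F(x)=\frac1m\sum_{i=1}^m h_i(c_i(x))+g(x)$ as described in the context, with $m\ge1$ terms, a real $\|\nabla c\|$ with $\sup_{x\in\operatorname{dom} g}\max_{i=1,\dots,m}\|\nabla c_i(x)\|\le\|\nabla c\|<\infty$, a point $x_0\in\operatorname{dom} g$, and a target accuracy $\varepsilon>0$, and suppose that $\inf F>-\infty$ and that each of the quantities $\|\nabla c\|$, $L$, $\beta$, $F(x_0)-\inf F$, $1/\varepsilon$ is at least $K$. Then the method, started at $x_0$, generates a random point $x$ satisfying $$\mathbb{E}\left[\|\mathcal{G}_{1/\mu}(x)\|^2\right]\le\varepsilon^2,\qquad \mu=L\beta,$$ after at most $$C\left(\frac{L\beta m}{\varepsilon^2}+\frac{L^2\beta\|\nabla c\|}{\varepsilon^3}\cdot\min\left\{\sqrt m,\frac{L\|\nabla c\|}{\varepsilon}\right\}\right)\cdot\big(F(x_0)-\inf F\big)\,\log\left(\frac{L\|\nabla c\|}{\varepsilon}\right)$$ basic operations.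
   Context: Setting: $g\colon\mathbf{R}^d\to\mathbf{R}\cup\{+\infty\}$ is proper, closed and convex; each $h_i\colon\mathbf{R}\to\mathbf{R}$ is convex and $L$-Lipschitz continuous; each $c_i\colon\mathbf{R}^d\to\mathbf{R}$ is $C^1$-smooth with $\beta$-Lipschitz gradient $\nabla c_i$. Set $\mu:=L\beta$. The problem is an instance of minimizing $g+h\circ c$ with $h(z_1,\ldots,z_m):=\frac1m\sum_{i=1}^m h_i(z_i)$ and $c(x):=(c_1(x),\ldots,c_m(x))$. For $t>0$ define $F_t(z;y):=g(z)+h\big(c(y)+\nabla c(y)(z-y)\big)+\frac{1}{2t}\|z-y\|^2$, $S_t(y):=\operatorname{argmin}_z F_t(z;y)$, and the prox-gradient $\mathcal{G}_t(x):=t^{-1}(x-S_t(x))$. Proximal maps: $\operatorname{prox}_{tf}(x):=\operatorname{argmin}_z\{f(z)+\frac{1}{2t}\|z-x\|^2\}$. A basic operation is an individual evaluation of some $c_i(x)$ or $\nabla c_i(x)$, a dot-product $\nabla c_i(x)^Tv$, or an evaluation of a proximal map $\operatorname{prox}_{th_i}$ or $\operatorname{prox}_{tg}$. The method has access to the problem only through basic operations (and ordinary vector arithmetic and random sampling of indices), together with the values $m$, $L$, $\beta$, $\|\nabla c\|$, $\varepsilon$. *)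

(* Defs.v *)
From HB Require Import structures.
From mathcomp Require Import all_boot all_order all_algebra.
From mathcomp Require Import all_classical all_reals all_analysis.

Set Implicit Arguments.
Unset Strict Implicit.
Unset Printing Implicit Defensive.

Import Order.TTheory GRing.Theory Num.Theory.
Import numFieldNormedType.Exports.

Local Open Scope classical_set_scope.
Local Open Scope ring_scope.

Section Euclidean.
Context {R : realType} {d : nat}.
Implicit Types (u v x : 'rV[R]_d) (c : 'rV[R]_d -> R).

Definition dot u v : R := \sum_j u 0 j * v 0 j.

(* The norm that the library puts on ['rV[R]_d] is the sup norm. *)
Definition enorm u : R := Num.sqrt (dot u u).

Definition gradient c x : 'rV[R]_d := \row_j 'D_(delta_mx 0 j) c x.

Definition C1_smooth c : Prop :=
  (forall x, differentiable c x) /\ continuous (gradient c).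

Definition lipschitz_gradient (b : R) c : Prop :=
  forall x y, enorm (gradient c x - gradient c y) <= b * enorm (x - y).

End Euclidean.

Section ConvexAnalysis.
Context {R : realType} {d : nat}.
Local Open Scope ereal_scope.
Implicit Types (g : 'rV[R]_d -> \bar R).

Definition dom g : set 'rV[R]_d := [set x | g x < +oo].

Definition proper_function g : Prop := (forall x, g x != -oo) /\ dom g !=set0.

(* At the endpoints the library convention [0 * +oo = 0] applies. *)
Definition ereal_convex g : Prop := forall (x y : 'rV[R]_d) (t : R),
  (0 <= t <= 1)%R ->
  g (t *: x + (1 - t) *: y)%R <= t%:E * g x + (1 - t)%:E * g y.

Definition proper_closed_convex g : Prop :=
  [/\ proper_function g, lower_semicontinuous g & ereal_convex g].

End ConvexAnalysis.

Definition argmin (T : Type) (disp : Order.disp_t) (Y : porderType disp)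
  (f : T -> Y) : set T := [set z | forall w, (f z <= f w)%O].

(* [get] picks an element; the functions minimized below are proper, closed and
   strongly convex whenever [g] and the [h i] are as assumed and [0 < t], so
   that the minimizer is then unique. *)
Definition the_argmin (T : pointedType) (disp : Order.disp_t)
  (Y : porderType disp) (f : T -> Y) : T := get (argmin f).

Definition prox {R : realType} {d : nat} (t : R) (g : 'rV[R]_d -> \bar R)
    (x : 'rV[R]_d) : 'rV[R]_d :=
  the_argmin (fun z => g z + ((2 * t)^-1 * enorm (z - x) ^+ 2)%:E)%E.

Definition prox1 {R : realType} (t : R) (h : R -> R) (s : R) : R :=
  the_argmin (fun r => h r + (2 * t)^-1 * `|r - s| ^+ 2).

Record problem (R : realType) (d m : nat) := Problem {
  reg : 'rV[R]_d -> \bar R;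
  outer : 'I_m -> R -> R;
  inner : 'I_m -> 'rV[R]_d -> R
}.

Section FiniteSum.
Context {R : realType} {d m : nat} (P : problem R d m).
Local Notation g := (reg P).
Local Notation h := (outer P).
Local Notation c := (inner P).

Record standing_assumptions (L b : R) : Prop := StandingAssumptions {
  reg_pcc : proper_closed_convex g;
  outer_convex : forall i, convex_function (setT : set R^o) (h i);
  outer_lipschitz : forall i, L.-lipschitz (h i);
  inner_C1 : forall i, C1_smooth (c i);
  inner_lipschitz : forall i, lipschitz_gradient b (c i)
}.

Definition mean_outer (z : 'I_m -> R) : R := m%:R^-1 * \sum_i h i (z i).

Definition objective (x : 'rV[R]_d) : \bar R :=
  ((mean_outer (fun i => c i x))%:E + g x)%E.

Definition inf_objective : \bar R := ereal_inf (range objective).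

Definition model (t : R) (y z : 'rV[R]_d) : \bar R :=
  (g z
   + (mean_outer (fun i => c i y + dot (gradient (c i) y) (z - y)))%:E
   + ((2 * t)^-1 * enorm (z - y) ^+ 2)%:E)%E.

Definition prox_linear_step (t : R) (y : 'rV[R]_d) : 'rV[R]_d :=
  the_argmin (model t y).

Definition prox_gradient (t : R) (x : 'rV[R]_d) : 'rV[R]_d :=
  t^-1 *: (x - prox_linear_step t x).

End FiniteSum.

(* A randomized first-order method handles vectors only symbolically: the
   vectors available to it are the linear combinations of those stored in a
   memory, where slot 0 holds the starting point and slot [k.+1] the answer to
   the [k]-th basic operation (or 0 if that answer was a scalar). It never
   reads coordinates, so inner products have to be paid for. *)
Definition lincomb (R : realType) : Type := seq (R * nat).

Definition eval_lincomb {R : realType} {d : nat} (M : seq 'rV[R]_d)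
  (e : lincomb R) : 'rV[R]_d := \sum_(p <- e) p.1 *: nth 0 M p.2.

Inductive basic_op (R : realType) (m : nat) : Type :=
| EvalInner of 'I_m & lincomb R
| EvalGrad of 'I_m & lincomb R
| EvalDot of 'I_m & lincomb R & lincomb R
| ProxOuter of {posnum R} & 'I_m & R
| ProxReg of {posnum R} & lincomb R.

Section Answers.
Context {R : realType} {d m : nat} (P : problem R d m).
Implicit Types (M : seq 'rV[R]_d) (o : basic_op R m).

Definition scalar_answer M o : R :=
  match o with
  | EvalInner i x => inner P i (eval_lincomb M x)
  | EvalDot i x v =>
      dot (gradient (inner P i) (eval_lincomb M x)) (eval_lincomb M v)
  | ProxOuter t i s => prox1 t%:num (outer P i) s
  | _ => 0
  end.

Definition vector_answer M o : 'rV[R]_d :=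
  match o with
  | EvalGrad i x => gradient (inner P i) (eval_lincomb M x)
  | ProxReg t x => prox t%:num (reg P) (eval_lincomb M x)
  | _ => 0
  end.

End Answers.

(* In state [q] the method draws [w] uniformly from [{0, ..., draw q}],
   performs the single basic operation [query q w] and moves to state
   [step q w a], where [a] is the scalar answer. [output q] is the point that
   the method holds in state [q]. Scalar computations are absorbed in the
   state and are not counted. *)
Record method (R : realType) (m : nat) := Method {
  state : Type;
  init : state;
  draw : state -> nat;
  query : state -> nat -> basic_op R m;
  step : state -> nat -> R -> state;
  output : state -> lincomb R
}.

Section Run.
Context {R : realType} {d m : nat} (P : problem R d m) (A : method R m).

(* Expectation of [phi] at the point held after [n] further basic operations,
   from state [q] with memory [M]. *)
Fixpoint expectation_from (phi : 'rV[R]_d -> R) (n : nat) (q : state A)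
    (M : seq 'rV[R]_d) : R :=
  if n is n'.+1 then
    (draw q).+1%:R^-1 *
    \sum_(w < (draw q).+1)
       let o := query q w in
       expectation_from phi n' (step q w (scalar_answer P M o))
         (rcons M (vector_answer P M o))
  else phi (eval_lincomb M (output q)).

Definition expectation_after (n : nat) (x0 : 'rV[R]_d)
    (phi : 'rV[R]_d -> R) : R :=
  expectation_from phi n (init A) [:: x0].

End Run.

(* Main.v *)
Require Import Defs.
From HB Require Import structures.
From mathcomp Require Import all_boot all_order all_algebra.
From mathcomp Require Import all_classical all_reals all_analysis.
From mathcomp Require Import ring lra.
Import Order.TTheory GRing.Theory Num.Theory.
Import numFieldNormedType.Exports.

Local Open Scope classical_set_scope.
Local Open Scope ring_scope.

(** Put [mu = L b] and [k = L G / e]. The proof has an outer and an inner part.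

    Outer part. The model of the problem at [y], which linearizes every [c i]
    and adds [mu / 2 |z - y|^2], lies above the objective [F]
    ([value_le_model]), agrees with it at [y] and is [mu]-strongly convex.
    Hence moving from [y] to a point whose model value is within [delta] of the
    minimum decreases [F] by at least [|p(y)|^2 / (2 mu) - delta], where [p] is
    the prox-gradient ([prox_linear_min], [stage_expect]). Summing over [j]
    stages, the mean of [|p|^2] over the iterates is at most [2 mu (F(x0) - inf
    F) / j + 2 mu delta] in expectation. Reservoir sampling makes the point
    that the method holds uniformly distributed over the iterates left so far,
    at every time and without knowing the total number of stages;
    [stages_expectation] combines this with the decrease of [F] in the single
    potential [count * |p(kept)|^2 + 2 mu F(current)]. With [delta = e^2 / (4
    mu)], any [j >= 4 mu (F(x0) - inf F) / e^2] is enough.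

    Inner part. An accuracy [delta] has to be reached with [O((m + sqrt m k)
    log k)] operations, since [m + sqrt m k] is at most [3 (m + k min(sqrt m,
    k))]. Each [h i] is replaced by its Moreau envelope with parameter [nu =
    e^2 / (4 mu L^2)], which changes values by at most [L^2 nu / 2 = delta / 2]
    and makes the saddle-point form of the subproblem strongly concave in the
    dual variable; it is strongly convex in the primal one. One step of the
    stochastic primal-dual coordinate method updates one random dual coordinate
    and the primal point, and it contracts the expectation of [lyapunov] by [1
    - 1 / (m + s)] for [s = 2 sqrt m k] ([coordinate_step_contracts]). Both
    updates are treated as monotone inclusions: the dual variables are slopes
    of envelopes, hence subgradients of the [h i].

    The logarithm must not depend on [m] nor on [F(x0) - inf F]. For this the
    stage starts at the minimizer of [g + mu / 2 |. - y|^2], which is within [L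
    G / mu] of the solution wherever [y] is, and it ends with the primal point
    that belongs to the current dual variable ([primal_of]): its gap is
    governed by the mean dual error alone ([primal_of_mix_gap]), and the ratio
    of the initial Lyapunov function to the coefficient of that error is [L^2]
    times a polynomial in [k] ([lyapunov_start]). A factor [k^-7] then suffices
    ([contraction_power], [stage_error_le]). *)

(** * Euclidean geometry and minimization of strongly convex functions *)

Section Dot.
Set Implicit Arguments. Unset Strict Implicit. Unset Printing Implicit Defensive.
Context {R : realType} {d : nat}.
Implicit Types (u v w x y z : 'rV[R]_d).

Lemma dotC u v : dot u v = dot v u.
Proof. by apply: eq_bigr => j _; rewrite mulrC. Qed.

Lemma dotDl u v w : dot (u + v) w = dot u w + dot v w.
Proof. by rewrite /dot -big_split; apply: eq_bigr => j _; rewrite mxE mulrDl. Qed.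

Lemma dotZl a u v : dot (a *: u) v = a * dot u v.
Proof. by rewrite /dot mulr_sumr; apply: eq_bigr => j _; rewrite mxE mulrA. Qed.

Lemma dotNl u v : dot (- u) v = - dot u v.
Proof. by rewrite -scaleN1r dotZl mulN1r. Qed.

Lemma dotDr u v w : dot u (v + w) = dot u v + dot u w.
Proof. by rewrite dotC dotDl !(dotC u). Qed.

Lemma dotZr a u v : dot u (a *: v) = a * dot u v.
Proof. by rewrite dotC dotZl dotC. Qed.

Lemma dotNr u v : dot u (- v) = - dot u v.
Proof. by rewrite dotC dotNl dotC. Qed.

Lemma dot0l u : dot 0 u = 0.
Proof. by rewrite -(scale0r 0) dotZl mul0r. Qed.

Lemma dot_suml (I : Type) (r : seq I) (f : I -> 'rV[R]_d) u :
  dot (\sum_(i <- r) f i) u = \sum_(i <- r) dot (f i) u.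
Proof.
by elim/big_rec2: _ => [|i s t _ <-]; rewrite ?dot0l // dotDl.
Qed.

Definition dotE := (dotDl, dotDr, dotNl, dotNr, dotZl, dotZr).

Lemma dot_ge0 u : 0 <= dot u u.
Proof. by apply: sumr_ge0 => j _; rewrite -expr2 sqr_ge0. Qed.

Lemma dot_eq0 u : dot u u = 0 -> u = 0.
Proof.
move=> /eqP; rewrite psumr_eq0 => [/allP u0|j _]; last by rewrite -expr2 sqr_ge0.
apply/rowP => j; rewrite mxE.
by have := u0 j; rewrite mem_index_enum mulf_eq0 orbb => /(_ isT)/eqP.
Qed.

Lemma enorm_ge0 u : 0 <= enorm u.
Proof. exact: sqrtr_ge0. Qed.

Lemma enorm_sqr u : enorm u ^+ 2 = dot u u.
Proof. by rewrite sqr_sqrtr // dot_ge0. Qed.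

Lemma enormN u : enorm (- u) = enorm u.
Proof. by rewrite /enorm dotNl dotNr opprK. Qed.

Lemma enormB u v : enorm (u - v) = enorm (v - u).
Proof. by rewrite -enormN opprB. Qed.

Lemma enormZ a u : enorm (a *: u) = `|a| * enorm u.
Proof.
by rewrite /enorm dotZl dotZr mulrA -expr2 sqrtrM ?sqr_ge0 // sqrtr_sqr.
Qed.

Lemma cauchy_schwarz u v : `|dot u v| <= enorm u * enorm v.
Proof.
rewrite -ler_sqr ?nnegrE ?normr_ge0 ?mulr_ge0 ?enorm_ge0 //.
rewrite exprMn !enorm_sqr real_normK ?num_real //.
have [v0|vn0] := eqVneq (dot v v) 0.
  by rewrite v0 (dot_eq0 v0) dotC dot0l expr0n mulr0.
have vp : 0 < dot v v by rewrite lt_def vn0 dot_ge0.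
have := dot_ge0 (dot v v *: u - dot u v *: v).
rewrite !dotE (dotC v u) => h.
have : 0 <= dot v v * (dot u u * dot v v - dot u v ^+ 2) by nra.
by rewrite pmulr_rge0 // subr_ge0.
Qed.

Lemma dot_le u v : dot u v <= enorm u * enorm v.
Proof. exact: le_trans (ler_norm _) (cauchy_schwarz u v). Qed.

Lemma dot_young c u v : 0 < c ->
  - dot u v <= c / 2 * dot u u + (2 * c)^-1 * dot v v.
Proof.
move=> c0; have := dot_ge0 (c *: u + v); rewrite !dotE (dotC v u) => h.
rewrite -subr_ge0.
have -> : c / 2 * dot u u + (2 * c)^-1 * dot v v - - dot u v =
   (2 * c)^-1 * (c * (c * dot u u) + c * dot u v + (c * dot u v + dot v v)).
  by field; rewrite gt_eqF.
by apply: mulr_ge0; [rewrite invr_ge0; lra | lra].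
Qed.

Lemma coord_enorm u j : `|u 0 j| <= enorm u.
Proof.
rewrite -ler_sqr ?nnegrE ?enorm_ge0 // enorm_sqr real_normK ?num_real //.
rewrite /dot (bigD1 j) //= -expr2 lerDl.
by apply: sumr_ge0 => k _; rewrite -expr2 sqr_ge0.
Qed.

Lemma norm_le_enorm u : `|u| <= enorm u.
Proof.
rewrite /Num.norm /=; have [->|/mx_norm_neq0[[i j] /= ->]] := eqVneq (mx_norm u) 0.
  exact: enorm_ge0.
by rewrite (ord1 i) coord_enorm.
Qed.

Lemma enorm_le_norm u : enorm u <= Num.sqrt d%:R * `|u|.
Proof.
rewrite -ler_sqr ?nnegrE ?mulr_ge0 ?sqrtr_ge0 ?enorm_ge0 //.
rewrite enorm_sqr exprMn sqr_sqrtr ?ler0n //.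
apply: (@le_trans _ _ (\sum_(j < d) `|u| ^+ 2)); last first.
  by rewrite sumr_const card_ord mulr_natl.
apply: ler_sum => j _; rewrite -expr2 -[X in X <= _]real_normK ?num_real //.
rewrite ler_sqr ?nnegrE //.
rewrite [leRHS]mx_normrE; apply: (le_bigmax _ (fun i : 'I_1 * 'I_d => `|u i.1 i.2|) (0, j)).
Qed.

(** The identity behind the strong convexity of [|. - z|^2]. *)
Lemma enorm_convex_comb x y z (t : R) :
  dot (t *: x + (1 - t) *: y - z) (t *: x + (1 - t) *: y - z)
  = t * dot (x - z) (x - z) + (1 - t) * dot (y - z) (y - z)
    - t * (1 - t) * dot (x - y) (x - y).
Proof. rewrite !dotE (dotC y x) (dotC z x) (dotC z y); ring. Qed.

End Dot.

(** First-order optimality: moving a fraction [t] of the way towards a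
    competitor changes a convex objective by [t a] up to a term of order [t^2].
    *)
Lemma ge0_of_small_slope (R : realType) (a b : R) :
  (forall t, 0 < t -> t <= 1 -> 0 <= t * a + t ^+ 2 * b) -> 0 <= a.
Proof.
move=> h; rewrite leNgt; apply/negP => a0.
(* At this [t <= 1], [t * |b|] is at most half of [- a]. *)
pose t := - a / (- a + 2 * `|b|).
have b0 : 0 <= `|b| := normr_ge0 b.
have bb : b <= `|b| := ler_norm b.
have t0 : 0 < t by apply: divr_gt0; lra.
have t1 : t <= 1 by rewrite /t ler_pdivrMr; lra.
have : t * (- a + 2 * `|b|) = - a by rewrite /t mulfVK // gt_eqF //; lra.
have := h t t0 t1; rewrite expr2; nra.
Qed.

Section StronglyConvex.
Set Implicit Arguments. Unset Strict Implicit. Unset Printing Implicit Defensive.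
Context {R : realType} {d : nat}.
Variables (D : set 'rV[R]_d) (f : 'rV[R]_d -> R) (lam : R).
Hypothesis lam0 : 0 < lam.
Hypothesis Dne : D !=set0.
Hypothesis f_sc : forall x y t, D x -> D y -> 0 <= t <= 1 ->
  D (t *: x + (1 - t) *: y) /\
  f (t *: x + (1 - t) *: y) <=
    t * f x + (1 - t) * f y - lam / 2 * (t * (1 - t)) * enorm (x - y) ^+ 2.
Hypothesis f_closed : forall x c,
  (forall r, 0 < r -> exists z, [/\ D z, enorm (z - x) < r & f z <= c]) ->
  D x /\ f x <= c.

(** Closedness bounds [f] below by [f x1 - 1] on a ball around a point [x1];
    restricted to a ray from [x1], strong convexity carries this bound out of
    the ball with at most linear loss, which the quadratic term compensates. *)
Lemma strongly_convex_bounded_below : exists B, forall z, D z -> B <= f z.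
Proof.
have [x1 Dx1] := Dne.
have [r r0 hr] : exists2 r, 0 < r & forall z, D z -> enorm (z - x1) < r -> f x1 - 1 < f z.
  apply: contrapT => /forall2NP nr.
  suff : f x1 <= f x1 - 1 by rewrite lerDl oppr_ge0 leNgt ltr01.
  apply: (proj2 (@f_closed x1 (f x1 - 1) _)) => r r0.
  case: (nr r) => // /existsNP[z /not_implyP[Dz /not_implyP[zr /negP]]].
  by rewrite -leNgt => fz; exists z.
(* [K] is the coefficient of the linear loss, removed by completing the square. *)
pose K := (2 / r + lam * r / 2).
exists (f x1 - 1 - K ^+ 2 / (2 * lam)) => z Dz.
have K20 : 0 <= K ^+ 2 / (2 * lam) by rewrite divr_ge0 ?sqr_ge0 ?mulr_ge0 ?ltW.
have [zr|zr] := ltP (enorm (z - x1)) r; first by have := hr z Dz zr; lra.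
set rho := enorm (z - x1) in zr *.
have rho0 : 0 < rho by exact: lt_le_trans zr.
(* Go to distance [r / 2], so as to be strictly inside the ball. *)
pose s := r / (2 * rho).
have s0 : 0 < s by rewrite divr_gt0 //; lra.
have s1 : s <= 1 by rewrite ler_pdivrMr; lra.
have srho : s * rho = r / 2 by rewrite /s; field; rewrite gt_eqF.
have s01 : 0 <= s <= 1 by rewrite ltW.
have [Dy fy] := f_sc Dz Dx1 s01.
have : f x1 - 1 < f (s *: z + (1 - s) *: x1).
  apply: hr => //.
  have -> : s *: z + (1 - s) *: x1 - x1 = s *: (z - x1).
    by apply/rowP => j; rewrite !mxE; ring.
  rewrite enormZ gtr0_norm // -/rho srho; lra.
rewrite -/rho in fy => hy.
have h : s * (f z - f x1) >= - 1 + lam / 2 * (s * (1 - s)) * rho ^+ 2 by lra.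
have h2 : f z - f x1 >= - (2 / r * rho) + lam / 2 * (rho ^+ 2 - r / 2 * rho).
  rewrite -(ler_pM2l s0); apply: le_trans h.
  have -> : s * (- (2 / r * rho) + lam / 2 * (rho ^+ 2 - r / 2 * rho))
    = - (2 / r * (s * rho)) + lam / 2 * (s * rho ^+ 2 - s * rho * (r / 2)) by ring.
  have -> : lam / 2 * (s * (1 - s)) * rho ^+ 2
     = lam / 2 * (s * rho ^+ 2 - (s * rho) ^+ 2) by ring.
  rewrite !srho.
  have -> : 2 / r * (r / 2) = 1 by field; rewrite gt_eqF.
  by rewrite expr2.
have h3 : lam / 2 * rho ^+ 2 - K * rho + K ^+ 2 / (2 * lam) = (lam * rho - K) ^+ 2 / (2 * lam).
  by field; rewrite gt_eqF.
have h4 : 0 <= (lam * rho - K) ^+ 2 / (2 * lam) by rewrite divr_ge0 ?sqr_ge0 ?mulr_ge0 ?ltW.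
have h5 : K * rho = 2 / r * rho + lam / 2 * (r * rho) by rewrite /K; ring.
have : 0 <= lam / 2 * (r * rho) by rewrite !mulr_ge0 // ?ltW //; lra.
lra.
Qed.

Lemma strongly_convex_growth p : D p -> (forall z, D z -> f p <= f z) ->
  forall z, D z -> f p + lam / 2 * enorm (z - p) ^+ 2 <= f z.
Proof.
move=> Dp pmin z Dz.
rewrite -subr_ge0; apply: (@ge0_of_small_slope _ _ (lam / 2 * enorm (z - p) ^+ 2)).
move=> t t0 t1.
have t01 : 0 <= t <= 1 by rewrite ltW.
have [Dt ft] := f_sc Dz Dp t01.
have := le_trans (pmin _ Dt) ft; rewrite expr2; lra.
Qed.

(** A minimizing sequence is Cauchy, by strong convexity at midpoints, and its
    limit is a minimizer by closedness. *)
Lemma strongly_convex_min : exists2 p, D p & forall z, D z -> f p <= f z.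
Proof.
have [B hB] := strongly_convex_bounded_below.
pose S := f @` D.
have Sne : S !=set0 by have [x Dx] := Dne; exists (f x), x.
have Slb : has_lbound S by exists B => _ [z Dz <-]; exact: hB.
have Sinf : has_inf S by split.
pose I := inf S.
have I_le z : D z -> I <= f z by move=> Dz; apply: ge_inf => //; exists z.
have near_inf n : exists z, D z /\ f z < I + n.+1%:R^-1.
  have [_ [z Dz <-] lt] := @inf_adherent R S n.+1%:R^-1 (ltac:(by rewrite invr_gt0)) Sinf.
  by exists z.
have [zs zsP] := choice near_inf.
have close n k z z' : D z -> D z' -> f z <= I + n -> f z' <= I + k ->
    lam / 4 * enorm (z - z') ^+ 2 <= n + k.
  move=> Dz Dz' fz fz'.
  have t01 : 0 <= (1/2 : R) <= 1 by apply/andP; split; lra.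
  have [Dt ft] := f_sc Dz Dz' t01; have := I_le _ Dt; nra.
have zs_close n k : (n <= k)%N -> enorm (zs n - zs k) ^+ 2 <= 8 / lam * n.+1%:R^-1.
  move=> nk; have [D1 f1] := zsP n; have [D2 f2] := zsP k.
  have f2' : f (zs k) <= I + n.+1%:R^-1.
    by apply: le_trans (ltW f2) _; rewrite lerD2l lef_pV2 ?posrE ?ltr0n // ler_nat.
  move: (close _ _ _ _ D1 D2 (ltW f1) f2') => h.
  set q := n.+1%:R^-1 in h *; set N := _ ^+ 2 in h *.
  by rewrite mulrAC ler_pdivlMr //; lra.
have small r : 0 < r -> exists n, forall k, (n <= k)%N -> enorm (zs n - zs k) < r.
  move=> r0.
  pose n := Num.bound (8 / lam / r ^+ 2).
  have hn : 8 / lam / r ^+ 2 < n.+1%:R.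
    apply: lt_trans (archi_boundP _) _; last by rewrite ltr_nat.
    by rewrite !divr_ge0 ?sqr_ge0 // ltW.
  exists n => k nk; rewrite -ltr_sqr ?nnegrE ?enorm_ge0 ?(ltW r0) //.
  apply: le_lt_trans (zs_close _ _ nk) _.
  by rewrite ltr_pdivrMr ?ltr0n // (mulrC (r ^+ 2)) -ltr_pdivrMr ?exprn_gt0.
have zs_cauchy : cauchy (zs @ \oo).
  apply: cauchy_exP => q q0; have [n hn] := small q q0.
  exists (zs n); exists n => // k /= nk; rewrite /ball_ /=.
  rewrite -ball_normE /=.
  by apply: le_lt_trans (hn k nk); exact: norm_le_enorm.
have zs_cvg : cvg (zs @ \oo) by apply/cauchy_cvgP.
pose p := lim (zs @ \oo).
have near_p r : 0 < r -> exists n0, forall k, (n0 <= k)%N -> enorm (zs k - p) < r.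
  move=> r0.
  have c0 : 0 < Num.sqrt d%:R + 1 :> R by rewrite ltr_wpDl ?sqrtr_ge0.
  have /cvgrPdist_lt /(_ (r / (Num.sqrt d%:R + 1)) (divr_gt0 r0 c0)) : zs @ \oo --> p by [].
  case=> n0 _ hn0.
  exists n0 => k nk; have := hn0 k nk; rewrite /= ltr_pdivlMr // => lt.
  rewrite enormB; apply: le_lt_trans (enorm_le_norm _) _; apply: le_lt_trans lt.
  by rewrite mulrC ler_wpM2l // lerDl.
have pclosed eta : 0 < eta -> D p /\ f p <= I + eta.
  move=> eta0; apply: f_closed => r r0; have [n0 hn0] := near_p r r0.
  pose k := (n0 + Num.bound eta^-1)%N.
  exists (zs k); have [Dk fk] := zsP k; split => //; first by apply: hn0; exact: leq_addr.
  apply: le_trans (ltW fk) _; rewrite lerD2l invf_ple ?posrE ?ltr0n //.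
  apply: le_trans (ltW (archi_boundP _)) _; first by rewrite invr_ge0 ltW.
  by rewrite ler_nat ltnW // ltnS leq_addl.
exists p; first by have [] := pclosed 1 ltr01.
move=> z Dz; apply/ler_addgt0Pr => eta eta0.
have [_ h] := pclosed eta eta0; apply: le_trans h _; rewrite lerD2r; exact: I_le.
Qed.

End StronglyConvex.

(** * The Moreau envelope of a convex Lipschitz function on the line *)

(** Convexity as an inequality between reals, for numbers rather than the
    bundled coefficients of [convex_function]. *)
Definition real_convex {R : realType} (h : R -> R) := forall r s t : R,
  0 <= t <= 1 -> h (t * r + (1 - t) * s) <= t * h r + (1 - t) * h s.

Definition real_lipschitz {R : realType} (L : R) (h : R -> R) :=
  forall r s : R, `|h r - h s| <= L * `|r - s|.

Section MoreauEnvelope.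
Set Implicit Arguments. Unset Strict Implicit. Unset Printing Implicit Defensive.
Context {R : realType}.
Variables (h : R -> R) (L : R).
Hypothesis h_convex : real_convex h.
Hypothesis h_lip : real_lipschitz L h.
Implicit Types (s t r : R).

Lemma lip_const_ge0 : 0 <= L.
Proof. by have := le_trans (normr_ge0 _) (h_lip 1 0); rewrite subr0 normr1 mulr1. Qed.

Lemma lip_lower x y : h x - L * `|x - y| <= h y.
Proof. by have := le_trans (ler_norm _) (h_lip x y); lra. Qed.

Lemma lip_continuous : continuous h.
Proof.
move=> x; apply/cvgrPdist_le => e e0.
have L1 : 0 < L + 1 by rewrite ltr_wpDl ?lip_const_ge0.
near=> y.
apply: le_trans (h_lip _ _) _.
apply: (@le_trans _ _ ((L + 1) * `|x - y|)); first by rewrite ler_wpM2r // lerDl.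
rewrite -ler_pdivlMl //.
near: y; apply: cvgr_dist_le; first exact: cvg_id.
by rewrite mulr_gt0 ?invr_gt0.
Unshelve. all: by end_near. Qed.

(** The Moreau envelope of [h] with parameter [t] at [s]. *)
Definition envelope t s :=
  h (prox1 t h s) + (2 * t)^-1 * (s - prox1 t h s) ^+ 2.

(** The derivative of [envelope t] at [s]; it is also the maximizer in the
    conjugate representation of the envelope, hence the dual variable. *)
Definition slope t s := (s - prox1 t h s) / t.

(** Outside the interval of radius [2 t L] around [s] the quadratic term beats
    the Lipschitz bound, so that a minimizer over this compact interval, which
    exists by continuity, is global. *)
Lemma prox1_min t s r : 0 < t ->
  envelope t s <= h r + (2 * t)^-1 * (s - r) ^+ 2.
Proof.
move=> t0; have L0 := lip_const_ge0.
have t2 : 0 < (2 * t)^-1 by rewrite invr_gt0 mulr_gt0.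
pose f r := h r + (2 * t)^-1 * `|r - s| ^+ 2.
pose B := 2 * t * L.
have B0 : 0 <= B by rewrite !mulr_ge0 // ltW.
have f_cont : continuous f.
  move=> x; apply: cvgD; first exact: lip_continuous.
  apply: cvgM; first exact: cvg_cst.
  rewrite /= expr2; under eq_fun do rewrite expr2.
  by apply: cvgM; apply: cvg_norm; apply: cvgB; [exact: cvg_id|exact: cvg_cst
    |exact: cvg_id|exact: cvg_cst].
have [p _ pmin] : exists2 c, c \in `[s - B, s + B] & forall r, r \in `[s - B, s + B] -> f c <= f r.
  by apply: EVT_min; [lra | exact: continuous_subspaceT].
have fs : f p <= f s by apply: pmin; rewrite in_itv /=; apply/andP; split; lra.
have argmin_p : argmin f p.
  move=> r'; have [r'B|r'B] := lerP `|r' - s| B.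
    by apply: pmin; rewrite in_itv /=; move: r'B; rewrite ler_norml => /andP[? ?];
      apply/andP; split; lra.
  apply: le_trans fs _; rewrite /f subrr normr0 expr0n mulr0 addr0.
  have := lip_lower s r'; rewrite distrC => hl.
  suff : L * `|r' - s| <= (2 * t)^-1 * `|r' - s| ^+ 2 by lra.
  rewrite expr2 mulrA ler_wpM2r // -(ler_pM2l (x := 2 * t)) ?mulr_gt0 //.
  by rewrite mulrA mulfV ?mul1r ?gt_eqF ?mulr_gt0 // ltW.
have /(_ r) : argmin f (prox1 t h s) by apply: getPex; exists p.
by rewrite /f !real_normK ?num_real // /envelope -!(sqrrN (_ - s)) !opprB.
Qed.

Lemma prox1E t s : 0 < t -> prox1 t h s = s - t * slope t s.
Proof. by move=> t0; rewrite /slope; field; rewrite gt_eqF. Qed.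

Lemma slope_subgradient t s r : 0 < t ->
  h (prox1 t h s) + slope t s * (r - prox1 t h s) <= h r.
Proof.
move=> t0; rewrite -subr_ge0; set p := prox1 t h s.
apply: (@ge0_of_small_slope _ _ ((2 * t)^-1 * (r - p) ^+ 2)) => a a0 a1.
have a01 : 0 <= a <= 1 by rewrite ltW.
have h1 := h_convex r p a01.
have := prox1_min s (a * r + (1 - a) * p) t0.
rewrite /envelope -/p => h2.
have -> : a * (h r - (h p + slope t s * (r - p))) + a ^+ 2 * ((2 * t)^-1 * (r - p) ^+ 2)
  = a * h r + (1 - a) * h p - h p
    + (2 * t)^-1 * ((s - (a * r + (1 - a) * p)) ^+ 2 - (s - p) ^+ 2).
  by rewrite /slope -/p; field; rewrite gt_eqF.
by rewrite mulrBr; lra.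
Qed.

(** Compare the subgradient inequality at [prox1 t h s + u] with the Lipschitz
    bound, for [u] the slope itself. *)
Lemma slope_bound t s : 0 < t -> `|slope t s| <= L.
Proof.
move=> t0; set p := prox1 t h s; set u := slope t s.
have := slope_subgradient s (p + u) t0; rewrite -/p -/u (addrC p u) addrK => h1.
have := le_trans (ler_norm _) (h_lip (u + p) p); rewrite addrK => h2.
have [->|u0] := eqVneq u 0; first by rewrite normr0 lip_const_ge0.
rewrite -(ler_pM2r (x := `|u|)) ?normr_gt0 //.
by rewrite -normrM -expr2 ger0_norm ?sqr_ge0 // expr2; lra.
Qed.

Lemma envelope_le t s : 0 < t -> envelope t s <= h s.
Proof.
by move=> t0; have := prox1_min s s t0; rewrite subrr expr0n mulr0 addr0.
Qed.

Lemma envelope_ge t s : 0 < t -> h s - L ^+ 2 * t / 2 <= envelope t s.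
Proof.
move=> t0; have hl := lip_lower s (prox1 t h s); rewrite /envelope.
set q := s - _ in hl *.
have : 0 <= (2 * t)^-1 * (`|q| - L * t) ^+ 2.
  by rewrite mulr_ge0 ?sqr_ge0 // invr_ge0 mulr_ge0 // ltW.
have -> : (2 * t)^-1 * (`|q| - L * t) ^+ 2
   = (2 * t)^-1 * `|q| ^+ 2 - L * `|q| + L ^+ 2 * t / 2 by field; rewrite gt_eqF.
rewrite real_normK ?num_real //; lra.
Qed.

(** Take the proximal point of [s] as a competitor at [s']. *)
Lemma envelope_upper t s s' : 0 < t ->
  envelope t s' <= envelope t s + slope t s * (s' - s) + (2 * t)^-1 * (s' - s) ^+ 2.
Proof.
move=> t0; apply: le_trans (prox1_min s' (prox1 t h s) t0) _.
rewrite /envelope /slope; set p := prox1 t h s.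
rewrite -subr_ge0 le_eqVlt; apply/orP; left; apply/eqP; field.
by rewrite gt_eqF.
Qed.

(** The subgradient inequality of [h] at the proximal point of [s]; what
    remains is a square. *)
Lemma envelope_tangent t s s' : 0 < t ->
  envelope t s + slope t s * (s' - s) <= envelope t s'.
Proof.
move=> t0; have := slope_subgradient s (prox1 t h s') t0.
rewrite {2}/envelope (prox1E s t0); set p' := prox1 t h s'; set u := slope t s => h1.
have -> : envelope t s = h (s - t * u) + t / 2 * u ^+ 2.
  by rewrite /envelope (prox1E s t0) -/u; field; rewrite gt_eqF.
have : 0 <= (2 * t)^-1 * (s' - p' - t * u) ^+ 2.
  by rewrite mulr_ge0 ?sqr_ge0 // invr_ge0 mulr_ge0 // ltW.
have -> : (2 * t)^-1 * (s' - p' - t * u) ^+ 2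
  = (2 * t)^-1 * (s' - p') ^+ 2 - u * (s' - p') + t / 2 * u ^+ 2.
  by field; rewrite gt_eqF.
lra.
Qed.

Lemma envelope_lip t : 0 < t -> real_lipschitz L (envelope t).
Proof.
move=> t0 s s'; wlog le : s s' / envelope t s' <= envelope t s.
  by move=> H; case: (leP (envelope t s') (envelope t s)) => [|/ltW] /H //;
    rewrite distrC (distrC s').
rewrite ger0_norm ?subr_ge0 //.
apply: (@le_trans _ _ (slope t s * (s - s'))).
  by have := envelope_tangent s s' t0; lra.
apply: le_trans (ler_norm _) _; rewrite normrM ler_wpM2r //; exact: slope_bound.
Qed.

Lemma envelope_convex t : 0 < t -> real_convex (envelope t).
Proof.
move=> t0 x y a /andP[a0 a1]; set w := a * x + _.
have := ler_wpM2l a0 (envelope_tangent w x t0).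
have a1' : 0 <= 1 - a by lra.
have := ler_wpM2l a1' (envelope_tangent w y t0).
set u := slope t w; set e := envelope t w => h1 h2.
have : a * (u * (x - w)) + (1 - a) * (u * (y - w)) = 0 by rewrite /w; ring.
lra.
Qed.

(** Slopes are subgradients at the proximal points, whatever the parameters.
    The two parameters differ below: a dual step uses a larger one than the
    smoothing. *)
Lemma slope_monotone t t' s s' : 0 < t -> 0 < t' ->
  0 <= (slope t s - slope t' s') * (prox1 t h s - prox1 t' h s').
Proof.
move=> t0 t0'; have := slope_subgradient s (prox1 t' h s') t0.
have := slope_subgradient s' (prox1 t h s) t0'; lra.
Qed.

End MoreauEnvelope.

(** * Proximal points of closed convex functions *)

Section ClosedConvex.
Set Implicit Arguments. Unset Strict Implicit. Unset Printing Implicit Defensive.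
Context {R : realType} {d : nat}.
Variable g : 'rV[R]_d -> \bar R.
Hypothesis g_pcc : proper_closed_convex g.
Implicit Types (x y z : 'rV[R]_d) (t c : R).
Local Notation gr z := (fine (g z)).

Lemma dom_fin_num z : dom g z -> g z = (gr z)%:E.
Proof.
case: g_pcc => [[gNy _] _ _]; rewrite /dom /= => dz.
by rewrite fineK // fin_numE gNy lt_eqF.
Qed.

Lemma dom_convex x y t : dom g x -> dom g y -> 0 <= t <= 1 ->
  dom g (t *: x + (1 - t) *: y) /\
  gr (t *: x + (1 - t) *: y) <= t * gr x + (1 - t) * gr y.
Proof.
move=> dx dy t01; case: (g_pcc) => [_ _ /(_ x y t t01)].
rewrite (dom_fin_num dx) (dom_fin_num dy) -!EFinM -EFinD => h.
have dz : dom g (t *: x + (1 - t) *: y).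
  by rewrite /dom /=; apply: le_lt_trans h _; rewrite ltry.
by split => //; move: h; rewrite (dom_fin_num dz) lee_fin.
Qed.

(** Closedness of the epigraph, which is what lower semicontinuity gives for
    the real-valued restriction of [g] to its domain. *)
Lemma dom_closed x c :
  (forall r, 0 < r -> exists z, [/\ dom g z, enorm (z - x) < r & gr z <= c]) ->
  dom g x /\ gr x <= c.
Proof.
move=> h; case: (g_pcc) => [_ glsc _].
have gx : (g x <= c%:E)%E.
  rewrite leNgt; apply/negP => /glsc[V /nbhs_ballP[r /= r0 hr] hV].
  have [z [dz zx gz]] := h r r0.
  have : (c%:E < g z)%E.
    apply: hV; apply: hr; rewrite -ball_normE /=.
    by apply: le_lt_trans (norm_le_enorm _) _; rewrite enormB.
  by rewrite (dom_fin_num dz) lte_fin ltNge gz.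
have dx : dom g x by rewrite /dom /=; apply: le_lt_trans gx _; rewrite ltry.
by split => //; move: gx; rewrite (dom_fin_num dx) lee_fin.
Qed.

Section RegularizedMin.
Variables (phi : 'rV[R]_d -> R) (M lam : R) (y : 'rV[R]_d).
Hypothesis phi_convex : forall x z t, 0 <= t <= 1 ->
  phi (t *: x + (1 - t) *: z) <= t * phi x + (1 - t) * phi z.
Hypothesis phi_lip : forall x z, phi x - phi z <= M * enorm (x - z).
Hypothesis M0 : 0 <= M.
Hypothesis lam0 : 0 < lam.

Let f z := gr z + phi z + lam / 2 * enorm (z - y) ^+ 2.

(** All minimizers that occur below, those of the proximal map, of the model
    and of the smoothed model, are of this form. *)
Lemma regularized_argmin :
  let p := the_argmin (fun z => (g z + (phi z + lam / 2 * enorm (z - y) ^+ 2)%:E)%E) in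
  dom g p /\ forall z, dom g z -> f p + lam / 2 * enorm (z - p) ^+ 2 <= f z.
Proof.
have dne : dom g !=set0 by case: g_pcc => [[]].
have f_sc x z t : dom g x -> dom g z -> 0 <= t <= 1 ->
  dom g (t *: x + (1 - t) *: z) /\
  f (t *: x + (1 - t) *: z) <=
    t * f x + (1 - t) * f z - lam / 2 * (t * (1 - t)) * enorm (x - z) ^+ 2.
  move=> dx dz t01; have [dt gt] := dom_convex dx dz t01; split => //.
  have := phi_convex x z t01.
  rewrite /f !enorm_sqr enorm_convex_comb; lra.
have f_cl x c :
  (forall r, 0 < r -> exists z, [/\ dom g z, enorm (z - x) < r & f z <= c]) ->
  dom g x /\ f x <= c.
  move=> h.
  have E0 := enorm_ge0 (x - y).
  pose q := phi x + lam / 2 * enorm (x - y) ^+ 2.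
  pose K := M + lam * enorm (x - y) + 1.
  have K0 : 0 < K by rewrite /K; have := mulr_ge0 (ltW lam0) E0; have := M0; lra.
  have hq z : q - K * enorm (z - x) <= phi z + lam / 2 * enorm (z - y) ^+ 2.
    have := phi_lip x z; rewrite (enormB x z) /q /K.
    rewrite -(subrKA x z (- y)); move: (z - x) (x - y) => u v.
    rewrite !enorm_sqr !dotE (dotC v u) => hp.
    have := dot_le (- u) v; rewrite dotNl enormN => h2.
    have := ler_wpM2l (ltW lam0) h2.
    have := mulr_ge0 (ltW lam0) (dot_ge0 u).
    have := enorm_ge0 u.
    have : lam * (enorm u * enorm v) = lam * enorm v * enorm u by ring.
    lra.
  have key eta : 0 < eta -> dom g x /\ gr x <= c - q + eta.
    move=> eta0; apply: dom_closed => r r0.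
    have r'0 : 0 < Num.min r (eta / K) by rewrite lt_min r0 divr_gt0.
    have [z [dz zx fz]] := h _ r'0.
    move: zx; rewrite lt_min => /andP[zr zK].
    exists z; split => //.
    move: zK; rewrite ltr_pdivlMr // => zK.
    have := hq z; rewrite /f in fz; lra.
  split; first by have [] := key 1 ltr01.
  apply/ler_addgt0Pr => eta eta0; have [_] := key eta eta0; rewrite /f /q; lra.
have [p dp pmin] := strongly_convex_min lam0 dne f_sc f_cl.
have growth := strongly_convex_growth f_sc dp pmin.
set F := fun z => _; have Fdom z : dom g z -> F z = (f z)%:E.
  by move=> dz; rewrite /F (dom_fin_num dz) /f -EFinD addrA.
have argp : argmin F p.
  move=> w; have [dw|ndw] := pselect (dom g w).
    by rewrite !Fdom // lee_fin pmin.
  have gw : g w = +oo%E by apply/eqP; rewrite -leye_eq leNgt; apply/negP.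
  by rewrite /F gw /= leey.
have : argmin F (the_argmin F) by apply: getPex; exists p.
set p' := the_argmin F => argp'.
have dp' : dom g p'.
  have := argp' p; rewrite (Fdom _ dp) => h.
  have: (F p' < +oo)%E by apply: le_lt_trans h _; rewrite ltry.
  by rewrite /dom /= /F; case: (g p') => [r|//|//] _; rewrite ltry.
have : p' = p.
  have := argp' p; rewrite (Fdom _ dp) (Fdom _ dp') lee_fin => h1; have h2 := growth _ dp'.
  apply/eqP; rewrite -subr_eq0; apply/eqP; apply: dot_eq0.
  rewrite -enorm_sqr; apply/eqP; rewrite eq_le sqr_ge0 andbT.
  have l2 : 0 < lam / 2 by rewrite divr_gt0.
  by rewrite -(ler_pM2l l2) mulr0; lra.
by move=> ->.
Qed.

End RegularizedMin.

(** For [phi = 0] the quadratic growth at the minimizer is, after expanding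
    squares, the subgradient inequality. *)
Lemma prox_subgradient t x : 0 < t ->
  dom g (prox t g x) /\
  forall z, dom g z ->
    gr (prox t g x) + t^-1 * dot (x - prox t g x) (z - prox t g x) <= gr z.
Proof.
move=> t0; have ti : 0 < t^-1 by rewrite invr_gt0.
have c0 : forall u v (a : R), 0 <= a <= 1 ->
  (fun _ : 'rV[R]_d => 0 : R) (a *: u + (1 - a) *: v) <= a * 0 + (1 - a) * 0.
  by move=> u v a _; rewrite !mulr0 addr0.
have l0 : forall u v : 'rV[R]_d,
   (fun _ : 'rV[R]_d => 0 : R) u - (fun _ : 'rV[R]_d => 0 : R) v <= 0 * enorm (u - v).
  by move=> u v; rewrite mul0r subr0.
have := @regularized_argmin (fun=> 0) 0 t^-1 x c0 l0 (lexx 0) ti.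
have -> : the_argmin (fun z => (g z + (0 + t^-1 / 2 * enorm (z - x) ^+ 2)%:E)%E) = prox t g x.
  by rewrite /prox; congr the_argmin; apply/funext => z; rewrite add0r invfM (mulrC 2^-1).
set p := prox t g x => /= -[dp pmin]; split => // z dz.
have := pmin z dz; rewrite !enorm_sqr !addr0 !dotE.
rewrite (dotC p x) (dotC z x) (dotC z p); lra.
Qed.

End ClosedConvex.

(** * The quadratic bound for Lipschitz gradients *)

Section DescentLemma.
Set Implicit Arguments. Unset Strict Implicit. Unset Printing Implicit Defensive.
Context {R : realType} {d : nat}.
Implicit Types (c : 'rV[R]_d -> R) (x y v : 'rV[R]_d).

Lemma derive_gradient c x v : differentiable c x ->
  'D_v c x = dot (gradient c x) v.
Proof.
move=> dc; rewrite deriveE // {1}(row_sum_delta v) linear_sum /dot.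
apply: eq_bigr => j _; rewrite linearZ /= mxE deriveE // mulrC //.
Qed.

(** Both difference quotients are the same function. *)
Lemma is_derive_line c x v (s : R) : differentiable c (x + s *: v) ->
  is_derive s (1 : R) (fun s => c (x + s *: v)) (dot (gradient c (x + s *: v)) v).
Proof.
move=> dc; have dcv := diff_derivable dc (v := v).
have E : (fun h : R => h^-1 *: (((fun s => c (x + s *: v)) \o shift s) (h *: 1) - c (x + s *: v)))
   = (fun h : R => h^-1 *: ((c \o shift (x + s *: v)) (h *: v) - c (x + s *: v))).
  apply/funext => h /=; congr (_ *: (c _ - _)).
  by apply/rowP => j; rewrite !mxE /GRing.scale /=; ring.
split; first by rewrite /derivable E.
by rewrite -derive_gradient // /derive E.
Qed.

(** For either sign, the error of the linearization along the segment, minus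
    the quadratic bound, has nonpositive derivative. *)
Lemma descent_lemma c (b : R) x y :
  (forall z, differentiable c z) -> lipschitz_gradient b c ->
  `|c y - (c x + dot (gradient c x) (y - x))| <= b / 2 * enorm (y - x) ^+ 2.
Proof.
move=> dc lc; set v := y - x.
pose k := b / 2 * enorm v ^+ 2.
have slope_le s : 0 <= s ->
    `|dot (gradient c (x + s *: v)) v - dot (gradient c x) v| <= 2 * k * s.
  move=> s0; rewrite -dotNl -dotDl; apply: le_trans (cauchy_schwarz _ _) _.
  apply: (@le_trans _ _ (b * enorm (s *: v) * enorm v)).
    apply: ler_wpM2r; first exact: enorm_ge0.
    by have := lc (x + s *: v) x; rewrite (addrAC x (s *: v) (- x)) subrr add0r.
  by rewrite enormZ ger0_norm // /k le_eqVlt; apply/orP; left; apply/eqP; field.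
have one_side (a : R) : `|a| <= 1 ->
    a * (c y - (c x + dot (gradient c x) v)) <= k.
  move=> a1.
  pose psi (s : R) := a * (c (x + s *: v) - s * dot (gradient c x) v) - k * s ^+ 2.
  pose dpsi (s : R) := a * (dot (gradient c (x + s *: v)) v - dot (gradient c x) v) - k * (2 * s).
  have psiD s : is_derive s (1 : R) psi (dpsi s).
    have := is_derive_line (dc (x + s *: v)) => D0.
    rewrite /psi; apply: is_derive_eq.
    by rewrite /dpsi /GRing.scale /=; ring.
  have : psi 1 <= psi 0.
    apply: (@ler0_derive1_nincr _ psi 0 1) => //.
    - move=> s; rewrite in_itv /= => /andP[s0 _]; rewrite derive1E derive_val /dpsi.
      have := slope_le s (ltW s0).
      set q := _ - _ => hq.
      have : a * q <= `|q|.
        apply: le_trans (ler_norm _) _; rewrite normrM.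
        by rewrite -[leRHS]mul1r ler_wpM2r.
      lra.
    - apply: continuous_subspaceT => s; apply: differentiable_continuous.
      by apply/derivable1_diffP; case: (psiD s).
  rewrite /psi scale1r scale0r addr0 expr1n expr0n /= mulr1 mulr0 mul1r mul0r.
  by rewrite /v subrKC -/v => h; rewrite mulrBr mulrDr in h *; lra.
rewrite ler_norml; apply/andP; split.
  by have := one_side (-1) (ltac:(by rewrite normrN1)); rewrite mulN1r -/k; lra.
by have := one_side 1 (ltac:(by rewrite normr1)); rewrite mul1r -/k; lra.
Qed.

End DescentLemma.

(** * The prox-linear subproblem and its stochastic primal-dual solution *)

Section Subproblem.
Set Implicit Arguments. Unset Strict Implicit. Unset Printing Implicit Defensive.
Context {R : realType} {d m : nat}.
Variables (g : 'rV[R]_d -> \bar R) (h : 'I_m -> R -> R) (L G : R).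
Variables (a : 'I_m -> 'rV[R]_d) (b : 'I_m -> R) (y : 'rV[R]_d) (mu nu : R).
Hypothesis m_gt0 : (0 < m)%N.
Hypothesis g_pcc : proper_closed_convex g.
Hypothesis h_convex : forall i, real_convex (h i).
Hypothesis h_lip : forall i, real_lipschitz L (h i).
Hypothesis a_bound : forall i, enorm (a i) <= G.
Hypothesis mu0 : 0 < mu.
Hypothesis nu0 : 0 < nu.
Local Notation gr z := (fine (g z)).
Local Notation mR := (m%:R : R).
Implicit Types (x z v w : 'rV[R]_d) (u : 'I_m -> R) (k : 'I_m -> R -> R).

(** The linearization at [y] of a function with value [b i] and gradient [a i]
    there. *)
Definition affine i z := b i + dot (a i) (z - y).

Definition average k z := mR^-1 * \sum_i k i (affine i z).

(** The gradient of the averaged linear form with dual weights [u]. *)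
Definition mix u : 'rV[R]_d := mR^-1 *: \sum_i u i *: a i.

Let mR0 : 0 < mR. Proof. by rewrite ltr0n. Qed.

Let G0 : 0 <= G.
Proof. exact: le_trans (enorm_ge0 _) (a_bound (Ordinal m_gt0)). Qed.

Lemma mean_const (c : R) : mR^-1 * \sum_(i < m) c = c.
Proof. by rewrite sumr_const card_ord -[c *+ m]mulr_natl mulKf // gt_eqF. Qed.

Lemma dot_mix u v : dot (mix u) v = mR^-1 * \sum_i u i * dot (a i) v.
Proof.
by rewrite /mix dotZl dot_suml; congr (_ * _); apply: eq_bigr => i _; rewrite dotZl.
Qed.

Lemma mixB u u' : mix u - mix u' = mix (fun i => u i - u' i).
Proof.
rewrite /mix -scalerBr -sumrB; congr (_ *: _); apply: eq_bigr => i _.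
by rewrite scalerBl.
Qed.

(** Jensen: pair [mix u] with itself, bound each [u i * dot (a i) (mix u)] by
    half the sum of squares, and absorb. *)
Lemma mix_sqr u : dot (mix u) (mix u) <= G ^+ 2 * (mR^-1 * \sum_i u i ^+ 2).
Proof.
set W := mix u.
have h1 : dot W W <= mR^-1 * \sum_i (G ^+ 2 * u i ^+ 2 + dot W W) / 2.
  apply: (@le_trans _ _ (mR^-1 * \sum_i u i * dot (a i) W)).
    by rewrite -dot_mix.
  rewrite ler_pM2l ?invr_gt0 //; apply: ler_sum => i _.
  have h2 : u i * dot (a i) W <= `|u i| * G * enorm W.
    apply: le_trans (ler_norm _) _; rewrite normrM -mulrA ler_wpM2l //.
    apply: le_trans (cauchy_schwarz _ _) _.
    by rewrite ler_wpM2r ?enorm_ge0 ?a_bound.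
  apply: le_trans h2 _; rewrite -(enorm_sqr W) -[u i ^+ 2]real_normK ?num_real //.
  have := sqr_ge0 (`|u i| * G - enorm W); rewrite sqrrB exprMn; lra.
move: h1; rewrite -mulr_suml big_split /= -mulr_sumr.
rewrite [mR^-1 * _]mulrA mulrDr [mR^-1 * \sum_(i < m) dot W W]mean_const.
lra.
Qed.

Lemma mix_bound u : (forall i, `|u i| <= L) -> enorm (mix u) <= L * G.
Proof.
move=> uL; have L0 := le_trans (normr_ge0 _) (uL (Ordinal m_gt0)).
rewrite -ler_sqr ?nnegrE ?enorm_ge0 ?mulr_ge0 // enorm_sqr.
apply: le_trans (mix_sqr u) _; rewrite exprMn mulrC ler_wpM2r ?sqr_ge0 //.
rewrite -[leRHS]mean_const ler_pM2l ?invr_gt0 //; apply: ler_sum => i _.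
by rewrite -[u i ^+ 2]real_normK ?num_real // ler_sqr ?nnegrE.
Qed.

Lemma affine_conv i x z t :
  affine i (t *: x + (1 - t) *: z) = t * affine i x + (1 - t) * affine i z.
Proof. by rewrite /affine !dotE; ring. Qed.

Lemma average_convex k x z t :
  (forall i, real_convex (k i)) ->
  0 <= t <= 1 ->
  average k (t *: x + (1 - t) *: z) <= t * average k x + (1 - t) * average k z.
Proof.
move=> kc t01; rewrite /average ![_ * (mR^-1 * _)]mulrCA -mulrDr.
rewrite ler_pM2l ?invr_gt0 // !mulr_sumr -big_split; apply: ler_sum => i _.
by rewrite affine_conv; exact: kc.
Qed.

Lemma average_lip k x z :
  (forall i, real_lipschitz L (k i)) ->
  average k x - average k z <= L * G * enorm (x - z).
Proof.
move=> kl; have L0 := lip_const_ge0 (kl (Ordinal m_gt0)).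
rewrite /average -mulrBr -sumrB -[leRHS]mean_const.
rewrite ler_pM2l ?invr_gt0 //; apply: ler_sum => i _.
apply: le_trans (ler_norm _) _; apply: le_trans (kl _ _ _) _.
rewrite -mulrA ler_wpM2l //.
have -> : affine i x - affine i z = dot (a i) (x - z) by rewrite /affine !dotE; ring.
apply: le_trans (cauchy_schwarz _ _) _.
by rewrite ler_wpM2r ?enorm_ge0 ?a_bound.
Qed.

(** The objective of the subproblem; for [k = h] it is the model at [y]. *)
Definition penalized k z := gr z + average k z + mu / 2 * enorm (z - y) ^+ 2.

Lemma penalized_argmin k :
  (forall i, real_convex (k i)) ->
  (forall i, real_lipschitz L (k i)) ->
  let p := the_argmin
    (fun z => (g z + (average k z + mu / 2 * enorm (z - y) ^+ 2)%:E)%E) in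
  dom g p /\
  forall z, dom g z -> penalized k p + mu / 2 * enorm (z - p) ^+ 2 <= penalized k z.
Proof.
move=> kc kl; apply: (@regularized_argmin _ _ _ g_pcc _ (L * G)) => //.
- by move=> x z t; exact: average_convex.
- by move=> x z; exact: average_lip.
- exact/mulr_ge0/G0/lip_const_ge0/(kl (Ordinal m_gt0)).
Qed.

Let L0 : 0 <= L.
Proof. exact: lip_const_ge0 (h_lip (Ordinal m_gt0)). Qed.

Definition smoothed i := envelope (h i) nu.

Definition primal_opt : 'rV[R]_d := the_argmin
  (fun z => (g z + (average smoothed z + mu / 2 * enorm (z - y) ^+ 2)%:E)%E).

Definition dual_opt i := slope (h i) nu (affine i primal_opt).

Local Notation xs := primal_opt.
Local Notation us := dual_opt.
Local Notation ws := (mix dual_opt).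

Lemma primal_opt_min : dom g xs /\
  forall z, dom g z -> penalized smoothed xs <= penalized smoothed z.
Proof.
have [] := @penalized_argmin smoothed.
- by move=> i; apply: envelope_convex.
- by move=> i; apply: envelope_lip.
move=> dp H; split => // z dz; apply: le_trans (H z dz).
by rewrite lerDl mulr_ge0 ?sqr_ge0 // divr_ge0 // ltW.
Qed.

Lemma average_smoothed_upper x v :
  average smoothed (x + v) <=
  average smoothed x + dot (mix (fun i => slope (h i) nu (affine i x))) v
  + mR^-1 * \sum_i (2 * nu)^-1 * dot (a i) v ^+ 2.
Proof.
rewrite dot_mix /average -!mulrDr ler_pM2l ?invr_gt0 // -!big_split /=.
apply: ler_sum => i _.
have -> : dot (a i) v = affine i (x + v) - affine i x by rewrite /affine !dotE; ring.
by apply: envelope_upper => //; exact: h_lip.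
Qed.

(** Since the envelopes are differentiable, the optimality of [primal_opt] for
    the sum becomes a subgradient of [g] alone, with the envelopes replaced by
    their slopes [dual_opt]. *)
Lemma primal_opt_subgradient z : dom g z ->
  gr xs + dot (mu *: (y - xs) - ws) (z - xs) <= gr z.
Proof.
move=> dz; have [dx xmin] := primal_opt_min.
set v := z - xs.
rewrite -subr_ge0; apply: (@ge0_of_small_slope _ _
  (mR^-1 * (\sum_i (2 * nu)^-1 * dot (a i) v ^+ 2) + mu / 2 * dot v v)).
move=> t t0 t1; have t01 : 0 <= t <= 1 by rewrite ltW.
have [dt gt] := dom_convex g_pcc dz dx t01.
have := xmin _ dt.
have E : t *: z + (1 - t) *: xs = xs + t *: v.
  by apply/rowP => j; rewrite !mxE; ring.
rewrite E in gt *; rewrite /penalized => h1.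
have := average_smoothed_upper xs (t *: v); rewrite -/us.
have -> : mR^-1 * (\sum_i (2 * nu)^-1 * dot (a i) (t *: v) ^+ 2)
  = t ^+ 2 * (mR^-1 * \sum_i (2 * nu)^-1 * dot (a i) v ^+ 2).
  rewrite mulrCA; congr (_ * _); rewrite mulr_sumr; apply: eq_bigr => i _.
  by rewrite dotZr; ring.
set S := mR^-1 * _; rewrite dotZr => h2.
have h3 : enorm (xs + t *: v - y) ^+ 2 =
  enorm (xs - y) ^+ 2 - 2 * t * dot (y - xs) v + t ^+ 2 * dot v v.
  rewrite !enorm_sqr -addrAC; move: (v) => v'; rewrite -(opprB xs y).
  by move: (xs - y) => q; rewrite !dotE (dotC v' q); ring.
rewrite h3 in h1; rewrite dotDl dotNl dotZl; lra.
Qed.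

(** The price of smoothing. *)
Lemma primal_opt_gap z : dom g z ->
  penalized h xs <= penalized h z + L ^+ 2 * nu / 2.
Proof.
move=> dz; have [dx /(_ z dz)] := primal_opt_min; rewrite /penalized.
have h1 : average h xs - L ^+ 2 * nu / 2 <= average smoothed xs.
  rewrite -[L ^+ 2 * nu / 2]mean_const /average -mulrBr ler_pM2l ?invr_gt0 //.
  rewrite -sumrB; apply: ler_sum => i _.
  by apply: envelope_ge => //; exact: h_lip.
have h2 : average smoothed z <= average h z.
  rewrite ler_pM2l ?invr_gt0 //; apply: ler_sum => i _.
  by apply: envelope_le => //; exact: h_lip.
lra.
Qed.

Lemma dual_opt_bound i : `|us i| <= L.
Proof. exact: slope_bound. Qed.

(** The minimizer of [g + mu / 2 |. - y|^2 + dot w], that is, the primal point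
    that belongs to dual weights with [mix u = w]. *)
Definition primal_of w := prox mu^-1 g (y - mu^-1 *: w).

Lemma primal_of_subgradient w : dom g (primal_of w) /\
  forall z, dom g z -> gr (primal_of w)
    + dot (mu *: (y - primal_of w) - w) (z - primal_of w) <= gr z.
Proof.
have mi : 0 < mu^-1 by rewrite invr_gt0.
have [dz H] := prox_subgradient g_pcc (y - mu^-1 *: w) mi.
split => // z /H; rewrite -/(primal_of w) invrK -dotZl.
suff -> : mu *: (y - mu^-1 *: w - primal_of w) = mu *: (y - primal_of w) - w by [].
by rewrite addrAC scalerBr scalerA mulfV ?scale1r // gt_eqF.
Qed.

(** Add the subgradient inequalities at [primal_of w] and at [primal_opt]. *)
Lemma primal_of_dist w : enorm (primal_of w - xs) <= enorm (w - ws) / mu.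
Proof.
have [dz H] := primal_of_subgradient w.
have [dx _] := primal_opt_min.
have h1 := H _ dx; have h2 := primal_opt_subgradient dz.
move: (primal_of w) h1 h2 => z h1 h2.
have : mu * dot (z - xs) (z - xs) <= dot (ws - w) (z - xs).
  move: h1 h2; rewrite -(opprB z xs).
  have -> : y - z = (y - xs) - (z - xs) by apply/rowP => j; rewrite !mxE; ring.
  move: (z - xs) (y - xs) => p q; rewrite !dotE; lra.
move=> /le_trans /(_ (dot_le _ _)); rewrite (enormB ws w) -enorm_sqr.
have := enorm_ge0 (z - xs); rewrite le_eqVlt => /orP[/eqP <- _|e0].
  by rewrite divr_ge0 ?enorm_ge0 // ltW.
by rewrite expr2 mulrA ler_pM2r // mulrC ler_pdivlMr // mulrC.
Qed.

(** The function [g] need not be Lipschitz, but the subgradient inequality at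
    [primal_of w] bounds the growth of [g + mu / 2 |. - y|^2] by an inner
    product with [w], and the average of the [h i] is Lipschitz. *)
Lemma primal_of_gap w :
  penalized h (primal_of w) <= penalized h xs
    + (2 * L * G * enorm (w - ws) + enorm (w - ws) ^+ 2) / mu.
Proof.
have [dz H] := primal_of_subgradient w.
have [dx _] := primal_opt_min.
have h1 := H _ dx; have dist := primal_of_dist w.
move: (primal_of w) dz H h1 dist => z dz H h1 dist.
have h2 := average_lip z xs h_lip.
have h3 : - dot w (z - xs) <= (L * G + enorm (w - ws)) * enorm (z - xs).
  have -> : - dot w (z - xs) = dot (ws - w) (z - xs) + dot (- ws) (z - xs).
    by rewrite dotDl !dotNl; lra.
  rewrite mulrDl addrC; apply: lerD.
    apply: le_trans (dot_le _ _) _; rewrite enormN ler_wpM2r ?enorm_ge0 //.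
    exact/mix_bound/dual_opt_bound.
  by apply: le_trans (dot_le _ _) _; rewrite enormB.
have h4 : penalized h z - penalized h xs
   <= (2 * L * G + enorm (w - ws)) * enorm (z - xs).
  rewrite /penalized !enorm_sqr.
  have : dot (z - y) (z - y) = dot (xs - y) (xs - y)
      - 2 * dot (y - z) (z - xs) - dot (z - xs) (z - xs).
    have -> : xs - y = (z - y) - (z - xs) by apply/rowP => j; rewrite !mxE; ring.
    rewrite -(opprB z y); move: (z - xs) (z - y) => p q.
    by rewrite !dotE (dotC p q); ring.
  move=> ->; move: h1; rewrite -(opprB z xs) dotNr (dotDl _ (- w)) (dotNl w) (dotZl mu) => h1.
  have := mulr_ge0 (ltW mu0) (dot_ge0 (z - xs)); lra.
suff : (2 * L * G + enorm (w - ws)) * enorm (z - xs)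
   <= (2 * L * G * enorm (w - ws) + enorm (w - ws) ^+ 2) / mu by lra.
have -> : (2 * L * G * enorm (w - ws) + enorm (w - ws) ^+ 2) / mu
   = (2 * L * G + enorm (w - ws)) * (enorm (w - ws) / mu) by rewrite expr2; ring.
by rewrite ler_wpM2l // addr_ge0 ?enorm_ge0 // !mulr_ge0.
Qed.

Section CoordinateStep.
Variables (s theta : R).
Hypothesis s0 : 0 < s.
Hypothesis s_large : mR * G ^+ 2 <= mu * nu * s ^+ 2.
Hypothesis theta0 : 0 <= theta.
Hypothesis theta1 : theta <= 1.
Hypothesis theta_primal : mu * s <= theta * (mu + mu * s).
Hypothesis theta_dual : nu + nu * s / mR - nu / mR <= theta * (nu + nu * s / mR).

Definition update u i c : 'I_m -> R := fun j => if j == i then c else u j.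

Lemma mix_update u i c :
  mix (update u i c) = mix u + (mR^-1 * (c - u i)) *: a i.
Proof.
rewrite /mix -scalerA -scalerDr; congr (_ *: _).
rewrite (bigD1 i) //= [in RHS](bigD1 i) //= /update eqxx.
rewrite (eq_bigr (fun j => u j *: a j)) => [|j /negbTE ->//].
by rewrite addrAC -scalerDl subrKC.
Qed.

Lemma sum_sqr_update u u' i c :
  \sum_j (update u i c j - u' j) ^+ 2 =
  \sum_j (u j - u' j) ^+ 2 + (c - u' i) ^+ 2 - (u i - u' i) ^+ 2.
Proof.
rewrite (bigD1 i) //= [in RHS](bigD1 i) //= /update eqxx.
rewrite (eq_bigr (fun j => (u j - u' j) ^+ 2)) => [|j /negbTE ->//].
by ring.
Qed.

(** The maximizer over [c] of the smoothed Lagrangian in the coordinate [i],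
    minus a proximal term [nu s / m * (c - u i)^2]; by the Moreau identity it
    is a slope of [h i] with a larger parameter. *)
Definition dual_step xb u i :=
  slope (h i) (nu + 2 * nu * s / mR) (affine i xb + 2 * nu * s / mR * u i).

(** The minimizer of [g + mu / 2 |. - y|^2 + dot v] plus the proximal term [mu
    s |. - x|^2]; the two quadratics are merged in one call to the proximal
    map. *)
Definition primal_step x v := prox (mu + 2 * mu * s)^-1 g
  ((mu + 2 * mu * s)^-1 *: (mu *: y + (2 * mu * s) *: x - v)).

(** Monotonicity of the subdifferential of [h i] between the dual step and the
    saddle point. *)
Lemma dual_step_monotone xb u i :
  let c := dual_step xb u i in
  nu * (c - us i) ^+ 2 + 2 * nu * s / mR * ((c - u i) * (c - us i))
  <= (c - us i) * dot (a i) (xb - xs).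
Proof.
cbv zeta; set c := dual_step xb u i; set sg := 2 * nu * s / mR.
have sg0 : 0 < sg by rewrite divr_gt0 // !mulr_gt0.
have om0 : 0 < nu + sg by rewrite addr_gt0.
have := slope_monotone (h_convex i) (h_lip i) (affine i xb + sg * u i)
  (affine i xs) om0 nu0.
rewrite !prox1E // -/(us i) -[slope _ _ _]/c.
have : affine i xb = affine i xs + dot (a i) (xb - xs).
  by rewrite /affine !dotE; ring.
move: (affine i xb) (affine i xs) (dot _ _) c (us i) => p q r c' u' ->.
lra.
Qed.

(** Monotonicity of the subdifferential of [g] between the primal step and the
    saddle point. *)
Lemma primal_step_monotone x v :
  let x' := primal_step x v in
  dom g x' /\
  mu * dot (x' - xs) (x' - xs) + 2 * mu * s * dot (x' - x) (x' - xs)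
  + dot (v - ws) (x' - xs) <= 0.
Proof.
move=> x'; have t0 : 0 < (mu + 2 * mu * s) by rewrite addr_gt0 // !mulr_gt0.
have ti0 : 0 < (mu + 2 * mu * s)^-1 by rewrite invr_gt0.
have [dx' H] := prox_subgradient g_pcc
  ((mu + 2 * mu * s)^-1 *: (mu *: y + (2 * mu * s) *: x - v)) ti0.
split => //; have [dx _] := primal_opt_min.
have := H _ dx; have := primal_opt_subgradient dx'.
rewrite -/(primal_step x v) -/x' invrK.
set p := _ *: (_ - v) - x'.
have -> : p = (mu + 2 * mu * s)^-1 *:
   (mu *: (y - xs) - mu *: (x' - xs) - (2 * mu * s) *: (x' - x) - v).
  by rewrite /p; apply/rowP => j; rewrite !mxE; field; rewrite gt_eqF.
rewrite dotZl mulrA mulfV ?gt_eqF // mul1r -(opprB x' xs) dotNr.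
move: (x' - xs) (x' - x) (y - xs) => q r e; rewrite !dotE; lra.
Qed.

(** Weighted squared distances to the saddle point and the squared last primal
    move, plus a coupling between the dual error and that move; the coupling is
    what the extrapolation in [coordinate_step_contracts] creates and consumes.
    *)
Definition lyapunov x xm u :=
  (mu + mu * s) * dot (x - xs) (x - xs)
  + (nu + nu * s / mR) * \sum_i (u i - us i) ^+ 2
  + dot (mix u - ws) (x - xm) + mu * s / 2 * dot (x - xm) (x - xm).

(** The hypothesis on [s] says exactly that the coupling of a dual change [c]
    with a primal move [v] is dominated by the proximal terms. *)
Lemma coupling_young (c : R) i v :
  - (c * dot (a i) v) <= mu * s / 2 * dot v v + nu * s / (2 * mR) * c ^+ 2.
Proof.
have ms0 : 0 < mu * s by exact: mulr_gt0.
have h1 := dot_young v (c *: a i) ms0; rewrite !dotZr dotZl (dotC v) in h1.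
apply: le_trans h1 _; rewrite lerD2l.
have h2 : dot (a i) (a i) <= G ^+ 2.
  by rewrite -enorm_sqr ler_sqr ?nnegrE ?enorm_ge0.
have h3 : G ^+ 2 <= (2 * (mu * s)) * (nu * s / (2 * mR)).
  have -> : (2 * (mu * s)) * (nu * s / (2 * mR)) = (mu * nu * s ^+ 2) / mR.
    by field; rewrite gt_eqF.
  by rewrite ler_pdivlMr // mulrC.
rewrite ler_pdivrMl ?mulr_gt0 // (mulrA c) -expr2 mulrA mulrC.
by rewrite ler_wpM2r ?sqr_ge0 // (le_trans h2).
Qed.

(** For a fixed coordinate, add the two monotonicity inequalities. The last
    inner product on the right vanishes on average over [i], because [mix] is
    the mean of the [u i *: a i]. *)
Lemma coordinate_step_bound x xm u i :
  let xb := x + theta *: (x - xm) in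
  let c := dual_step xb u i in
  let x' := primal_step x (mix u + (c - u i) *: a i) in
  lyapunov x' x (update u i c) <=
    mu * s * dot (x - xs) (x - xs)
    + (nu + nu * s / mR) * \sum_j (u j - us j) ^+ 2 - nu * (u i - us i) ^+ 2
    + theta * dot (mix u - ws) (x - xm)
    + theta * (mu * s / 2) * dot (x - xm) (x - xm)
    - dot (mix u - ws - (u i - us i) *: a i) (xb - xs).
Proof.
cbv zeta; set xb := x + _; set c := dual_step xb u i; set x' := primal_step _ _.
have [_ hp] := primal_step_monotone x (mix u + (c - u i) *: a i).
rewrite -/x' in hp.
have := dual_step_monotone xb u i; cbv zeta; rewrite -/c => hd.
rewrite /lyapunov sum_sqr_update mix_update.
set Q := \sum_j _.
have y1 := coupling_young (c - u i) i (x' - x).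
have y2 := coupling_young (- (c - u i)) i (x - xm).
have mi1 : mR^-1 <= 1 by rewrite invf_le1 // ler1n.
have mi0 : 0 <= mR^-1 by rewrite invr_ge0 ltW.
move: hp hd y1 y2.
have -> : x' - xs = (x' - x) + (x - xs) by rewrite subrKA.
have -> : xb - xs = (x - xs) + theta *: (x - xm) by rewrite /xb addrAC.
have -> : mix u + (c - u i) *: a i - ws = (mix u - ws) + (c - u i) *: a i by rewrite addrAC.
have -> : mix u + (mR^-1 * (c - u i)) *: a i - ws
   = (mix u - ws) + (mR^-1 * (c - u i)) *: a i by rewrite addrAC.
have -> : c - us i = (c - u i) + (u i - us i) by rewrite subrKA.
have -> : nu * s / (2 * mR) = nu * s / mR / 2 by field; rewrite gt_eqF.
have -> : 2 * nu * s / mR = 2 * (nu * s / mR) by rewrite !mulrA.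
set q := nu * s / mR.
move: (x' - x) (x - xs) (x - xm) (mix u - ws) (a i) (c - u i) (u i - us i)
  => X Z Y W A dl e.
rewrite !dotE (dotC Z X) sqrrN => hp hd y1 y2.
have y1' : - ((1 - mR^-1) * (dl * dot A X)) <=
   (mu * s / 2 * dot X X + q / 2 * dl ^+ 2).
  have p0 : 0 <= mu * s / 2 * dot X X + q / 2 * dl ^+ 2.
    have q0 : 0 <= q by rewrite divr_ge0 ?mulr_ge0 // ltW.
    by rewrite addr_ge0 // mulr_ge0 ?dot_ge0 ?sqr_ge0 // divr_ge0 ?mulr_ge0 // ltW.
  nra.
have y2' : theta * (dl * dot A Y) <=
   theta * (mu * s / 2 * dot Y Y) + q / 2 * dl ^+ 2.
  have q0 : 0 <= q / 2 * dl ^+ 2.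
    by rewrite mulr_ge0 ?sqr_ge0 // !divr_ge0 ?mulr_ge0 // ltW.
  have := ler_wpM2l theta0 y2; have := ler_wpM2r q0 theta1; lra.
lra.
Qed.

(** Average the previous bound over the coordinates. The hypotheses on [theta]
    make every remaining coefficient at most [theta] times the one in
    [lyapunov]. *)
Lemma coordinate_step_contracts x xm u :
  mR^-1 * \sum_i
    (let c := dual_step (x + theta *: (x - xm)) u i in
     lyapunov (primal_step x (mix u + (c - u i) *: a i)) x (update u i c))
  <= theta * lyapunov x xm u.
Proof.
set xb := x + _.
set Q := \sum_j (u j - us j) ^+ 2.
pose B := mu * s * dot (x - xs) (x - xs) + (nu + nu * s / mR) * Q
    + theta * dot (mix u - ws) (x - xm)
    + theta * (mu * s / 2) * dot (x - xm) (x - xm)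
    - dot (mix u - ws) (xb - xs).
apply: (@le_trans _ _ (mR^-1 * \sum_i
   (B + ((u i - us i) * dot (a i) (xb - xs) - nu * (u i - us i) ^+ 2)))).
  rewrite ler_pM2l ?invr_gt0 //; apply: ler_sum => i _.
  apply: le_trans (coordinate_step_bound x xm u i) _.
  by rewrite -/xb -/Q /B (dotDl (mix u - ws) (- _)) dotNl dotZl; lra.
rewrite big_split /= mulrDr (mean_const B) sumrB -mulr_sumr mulrBr.
rewrite -(dot_mix (fun i => u i - us i)) -mixB -/Q /lyapunov -/Q.
have Q0 : 0 <= Q by apply: sumr_ge0 => i _; exact: sqr_ge0.
have := ler_wpM2r Q0 theta_dual; have := ler_wpM2r (dot_ge0 (x - xs)) theta_primal.
rewrite /B; lra.
Qed.

(** The coupling term is absorbed by the last primal move and by a part of the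
    dual distance. *)
Lemma lyapunov_dual x xm u :
  nu * (mR + s) / (2 * mR) * \sum_i (u i - us i) ^+ 2 <= lyapunov x xm u.
Proof.
rewrite /lyapunov; set Q := \sum_i _.
have Q0 : 0 <= Q by apply: sumr_ge0 => i _; exact: sqr_ge0.
have ms0 : 0 < mu * s by exact: mulr_gt0.
have h1 := dot_young (x - xm) (mix u - ws) ms0.
have h2 : dot (mix u - ws) (mix u - ws) <= G ^+ 2 * (mR^-1 * Q).
  by rewrite mixB; exact: mix_sqr.
have h3 : (2 * (mu * s))^-1 * dot (mix u - ws) (mix u - ws)
    <= nu * s / (2 * mR) * Q.
  rewrite ler_pdivrMl ?mulr_gt0 //; apply: le_trans h2 _.
  rewrite [X in _ <= X]mulrA [X in X <= _]mulrA ler_wpM2r //.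
  rewrite ler_pdivrMr //.
  have -> : 2 * (mu * s) * (nu * s / (2 * mR)) * mR = mu * nu * s ^+ 2.
    by field; rewrite gt_eqF.
  by apply: le_trans s_large; rewrite ler_peMl ?sqr_ge0 ?ler1n.
have -> : nu * (mR + s) / (2 * mR) = nu / 2 + nu * s / (2 * mR).
  by field; rewrite gt_eqF.
have -> : nu * s / mR = nu * s / (2 * mR) + nu * s / (2 * mR).
  by field; rewrite gt_eqF.
have n0 : 0 <= nu * s / (2 * mR) * Q.
  by rewrite !mulr_ge0 ?invr_ge0 ?mulr_ge0 // ltW.
have h4 : 0 <= (mu + mu * s) * dot (x - xs) (x - xs).
  by rewrite mulr_ge0 ?dot_ge0 // addr_ge0 // ltW.
have h5 : 0 <= nu * Q by rewrite mulr_ge0 // ltW.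
rewrite (dotC (x - xm) (mix u - ws)) in h1; lra.
Qed.

(** [primal_of 0] is within [L G / mu] of [primal_opt] for every [y], and dual
    weights are bounded by [L]. *)
Lemma lyapunov_start :
  lyapunov (primal_of 0) (primal_of 0) (fun=> 0) <=
  (1 + s) * (L ^+ 2 * G ^+ 2) / mu + nu * (mR + s) * L ^+ 2.
Proof.
rewrite /lyapunov subrr dotC dot0l (dotC 0) dot0l mulr0 !addr0.
have LG : enorm ws <= L * G by exact/mix_bound/dual_opt_bound.
apply: lerD.
  have h1 : dot (primal_of 0 - xs) (primal_of 0 - xs) <= L ^+ 2 * G ^+ 2 / mu ^+ 2.
    rewrite -enorm_sqr -exprMn -expr_div_n ler_sqr ?nnegrE ?enorm_ge0 //; last first.
      by rewrite divr_ge0 ?mulr_ge0 // ltW.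
    apply: le_trans (primal_of_dist 0) _.
    by rewrite ler_pM2r ?invr_gt0 // add0r enormN.
  have -> : (1 + s) * (L ^+ 2 * G ^+ 2) / mu = (mu + mu * s) * (L ^+ 2 * G ^+ 2 / mu ^+ 2).
    by field; rewrite gt_eqF.
  by rewrite ler_pM2l // addr_gt0 // mulr_gt0.
have -> : nu * (mR + s) * L ^+ 2 = (nu + nu * s / mR) * (mR * L ^+ 2).
  by field; rewrite gt_eqF.
rewrite ler_pM2l; last by rewrite addr_gt0 // divr_gt0 ?mulr_gt0.
rewrite -ler_pdivrMl // -[leRHS]mean_const ler_pM2l ?invr_gt0 //.
apply: ler_sum => i _; rewrite sub0r sqrrN -[_ ^+ 2]real_normK ?num_real //.
by rewrite ler_sqr ?nnegrE // dual_opt_bound.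
Qed.

(** The gap is linear in the dual error, since [h] is not smooth; splitting it
    with [eta] makes it affine in the squared error, so that expectations can
    be taken. *)
Lemma primal_of_mix_gap x xm u z (eta : R) : 0 < eta -> dom g z ->
  penalized h (primal_of (mix u)) <= penalized h z
    + (L ^+ 2 * nu / 2 + eta / mu
       + (1 + (L * G) ^+ 2 / eta) * (2 * G ^+ 2) / (mu * nu * (mR + s))
         * lyapunov x xm u).
Proof.
move=> eta0 dz; apply: le_trans (primal_of_gap _) _.
have h1 := primal_opt_gap dz.
set E := enorm (mix u - ws).
have h2 : 2 * L * G * E <= eta + (L * G) ^+ 2 / eta * E ^+ 2.
  rewrite -subr_ge0.
  have -> : eta + (L * G) ^+ 2 / eta * E ^+ 2 - 2 * L * G * E = (L * G * E - eta) ^+ 2 / eta.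
    by field; rewrite gt_eqF.
  by rewrite divr_ge0 ?sqr_ge0 // ltW.
have h3 : E ^+ 2 <= (2 * G ^+ 2) / (nu * (mR + s)) * lyapunov x xm u.
  have h4 : E ^+ 2 <= G ^+ 2 * (mR^-1 * \sum_i (u i - us i) ^+ 2).
    by rewrite /E enorm_sqr mixB; exact: mix_sqr.
  apply: le_trans h4 _.
  have ms0 : 0 < mR + s by exact: addr_gt0.
  have -> : G ^+ 2 * (mR^-1 * \sum_i (u i - us i) ^+ 2) =
     (2 * G ^+ 2) / (nu * (mR + s)) * (nu * (mR + s) / (2 * mR) * \sum_i (u i - us i) ^+ 2).
    by field; rewrite !gt_eqF.
  by rewrite ler_wpM2l ?lyapunov_dual // divr_ge0 ?mulr_ge0 ?sqr_ge0 // ltW.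
have h4 : (2 * L * G * E + E ^+ 2) / mu <=
    eta / mu + (1 + (L * G) ^+ 2 / eta) * (2 * G ^+ 2) / (mu * nu * (mR + s))
         * lyapunov x xm u.
  have ms0 : 0 < mR + s by exact: addr_gt0.
  have -> : eta / mu + (1 + (L * G) ^+ 2 / eta) * (2 * G ^+ 2) / (mu * nu * (mR + s))
      * lyapunov x xm u
    = (eta + (1 + (L * G) ^+ 2 / eta) * ((2 * G ^+ 2) / (nu * (mR + s)) * lyapunov x xm u)) / mu.
    by field; rewrite !gt_eqF.
  rewrite ler_pM2r ?invr_gt0 //.
  have c0 : 0 <= 1 + (L * G) ^+ 2 / eta by rewrite addr_ge0 // divr_ge0 ?sqr_ge0 // ltW.
  have := ler_wpM2l c0 h3; lra.
lra.
Qed.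

End CoordinateStep.

End Subproblem.

(** * Randomized programs and their repetition *)

Section Lincomb.
Set Implicit Arguments. Unset Strict Implicit. Unset Printing Implicit Defensive.
Context {R : realType} {d : nat}.
Implicit Types (M : seq 'rV[R]_d) (e : lincomb R) (v : 'rV[R]_d).

(** The value of [e] remains [v] however the memory grows. *)
Definition denotes M e v := forall M', eval_lincomb (M ++ M') e = v.

Definition slot (n : nat) : lincomb R := [:: (1, n)].

Definition lscale (c : R) e : lincomb R := [seq (c * p.1, p.2) | p <- e].

Lemma denotes_eval M e v : denotes M e v -> eval_lincomb M e = v.
Proof. by move=> /(_ [::]); rewrite cats0. Qed.

Lemma denotes_rcons M e v v' : denotes M e v -> denotes (rcons M v') e v.
Proof. by move=> h M'; rewrite cat_rcons. Qed.

Lemma denotes_nil M : denotes M [::] 0.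
Proof. by move=> M'; rewrite /eval_lincomb big_nil. Qed.

Lemma denotes_cat M e e' v v' :
  denotes M e v -> denotes M e' v' -> denotes M (e ++ e') (v + v').
Proof.
by move=> h h' M'; rewrite -(h M') -(h' M') /eval_lincomb big_cat.
Qed.

Lemma denotes_scale M c e v : denotes M e v -> denotes M (lscale c e) (c *: v).
Proof.
move=> h M'; rewrite -(h M') /eval_lincomb big_map scaler_sumr.
by apply: eq_bigr => p _; rewrite scalerA.
Qed.

Lemma denotes_slot M n v : size M = n -> denotes (rcons M v) (slot n) v.
Proof.
move=> <- M'; rewrite /eval_lincomb big_seq1 scale1r.
by rewrite nth_cat size_rcons leqnn nth_rcons ltnn eqxx.
Qed.

End Lincomb.

Section Program.
Set Implicit Arguments. Unset Strict Implicit. Unset Printing Implicit Defensive.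
Context {R : realType} {m : nat}.

(** A finite decision tree of basic operations, each with a uniform draw from
    [{0, ..., k}] for [Ask k], and with a result at each leaf. *)
Inductive program (B : Type) : Type :=
| Return of B
| Ask of nat & (nat -> basic_op R m) & (nat -> R -> program B).

Section Cost.
Variable B : Type.

Fixpoint performs (n : nat) (p : program B) : Prop :=
  match p with
  | Return _ => n = 0%N
  | Ask _ _ next => exists2 n', n = n'.+1 & forall w r, performs n' (next w r)
  end.

Lemma performs_ask n k q (next : nat -> R -> program B) :
  (forall w r, performs n (next w r)) -> performs n.+1 (Ask k q next).
Proof. by exists n. Qed.

End Cost.

Section Expect.
Context {d : nat} (P : problem R d m) (B : Type).

Fixpoint expect (p : program B) (M : seq 'rV[R]_d)
    (f : B -> seq 'rV[R]_d -> R) : R :=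
  match p with
  | Return b => f b M
  | Ask k q next =>
    k.+1%:R^-1 * \sum_(w < k.+1)
      expect (next w (scalar_answer P M (q w)))
        (rcons M (vector_answer P M (q w))) f
  end.

Lemma expect_ask k q (next : nat -> R -> program B) M f :
  expect (Ask k q next) M f =
  k.+1%:R^-1 * \sum_(w < k.+1)
    expect (next w (scalar_answer P M (q w)))
      (rcons M (vector_answer P M (q w))) f.
Proof. by []. Qed.

Lemma expect_ask0 q (next : nat -> R -> program B) M f :
  expect (Ask 0 q next) M f =
  expect (next 0%N (scalar_answer P M (q 0%N)))
    (rcons M (vector_answer P M (q 0%N))) f.
Proof. by rewrite expect_ask big_ord1 invr1 mul1r. Qed.

Lemma expect_scale p M f (r : R) :
  r * expect p M f = expect p M (fun b M' => r * f b M').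
Proof.
elim: p M => [//|k q next IH] M; rewrite !expect_ask mulrCA; congr (_ * _).
by rewrite mulr_sumr; apply: eq_bigr => w _; exact: IH.
Qed.

End Expect.

Section Repeat.
Variables (B : Type) (stage : B -> program B) (held : B -> lincomb R) (b0 : B).

Definition repeat_step (next : program B) (e : lincomb R) :=
  if next is Return b then (held b, stage b) else (e, next).

(** The method that runs [stage] again and again, each time from the result of
    the previous run; between two ends of a stage it holds the point of the
    last result. *)
Definition repeat_method : method R m :=
  @Method R m (lincomb R * program B) (held b0, stage b0)
    (fun q => if q.2 is Ask k _ _ then k else 0%N)
    (fun q w => if q.2 is Ask _ o _ then o w else ProxReg m 1%:pos [::])
    (fun q w r => if q.2 is Ask _ _ next then repeat_step (next w r) q.1 else q)
    (fun q => q.1).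

Context {d : nat} (P : problem R d m) (phi : 'rV[R]_d -> R).
Local Notation expectation n e p M :=
  (@expectation_from R d m P repeat_method phi n (e, p) M).

(** The Markov property at the end of a stage. *)
Lemma expectation_stage l n e p M : performs l.+1 p ->
  expectation (l.+1 + n) e p M =
  expect P p M (fun b M' => expectation n (held b) (stage b) M').
Proof.
elim: l p M => [|l IH] p M; case: p => [b []//|k q next] [_ [<-] H] /=.
  congr (_ * _); apply: eq_bigr => w _; set M' := rcons _ _; set r := scalar_answer _ _ _.
  by have := H w r; case: (next w r) => [b _|? ? ? []].
congr (_ * _); apply: eq_bigr => w _; set M' := rcons _ _; set r := scalar_answer _ _ _.
have := H w r; case: (next w r) => [b []//|k' q' next'] Hp.
by rewrite -(IH (Ask k' q' next')); last exact: Hp.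
Qed.

Lemma expectation_mid_stage n l e p M v : performs l p -> (n < l)%N ->
  denotes M e v -> expectation n e p M = phi v.
Proof.
elim: n l p M => [|n IH] l p M Hp nl Me; first by rewrite /= (denotes_eval Me).
case: p Hp => [b /= l0|k q next [l' ll' H]]; first by rewrite l0 in nl.
rewrite /= (eq_bigr (fun=> phi v)) => [|w _].
  by rewrite sumr_const card_ord -[phi v *+ _]mulr_natl mulKf // pnatr_eq0.
set M' := rcons _ _; set r := scalar_answer _ _ _.
rewrite ll' ltnS in nl.
rewrite -(IH l' (next w r) M' (H w r) nl); last exact: denotes_rcons.
have := H w r; case: (next w r) => [b l0|]; last by [].
by rewrite l0 in nl.
Qed.

End Repeat.
End Program.

(** * The method and the expected progress of a stage *)

(** The method has to be defined for all values of its parameters, but step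
    sizes are positive; the default is 1. *)
Definition pos_of {R : realType} (r : R) : {posnum R} :=
  if pselect (0 < r) is left r0 then PosNum r0 else 1%:pos.

Lemma pos_ofE {R : realType} (r : R) : 0 < r -> (pos_of r)%:num = r.
Proof. by rewrite /pos_of; case: pselect. Qed.

Section StageProgram.
Set Implicit Arguments. Unset Strict Implicit. Unset Printing Implicit Defensive.
Context {R : realType} {m' : nat}.
Local Notation m := m'.+1.
Variables (mu nu s theta : R).

(** Five operations: a value and a directional derivative of [c i], which give
    the linearization at the extrapolated point, the proximal maps of [h i] and
    of [g], and a gradient. If [t] is the size of the memory, the three scalar
    answers occupy the next three slots, so that the gradient of [c i] is [slot
    t.+3] and the new primal point [slot t.+4]. *)
Definition coordinate_step {B : Type} (t : nat) (x z zm w : lincomb R)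
    (u : 'I_m -> R) (next : lincomb R -> ('I_m -> R) -> program B) : program B :=
  let zb := z ++ lscale theta (z ++ lscale (-1) zm) in
  let sg := 2 * nu * s / m%:R in
  let om := (mu + 2 * mu * s)^-1 in
  Ask m' (fun j => EvalInner (inord j) x) (fun j c => let i := inord j in
  Ask 0 (fun=> EvalDot i x (zb ++ lscale (-1) x)) (fun _ r =>
  let q := c + r + sg * u i in
  Ask 0 (fun=> ProxOuter (pos_of (nu + sg)) i q) (fun _ p =>
  let ui := (q - p) / (nu + sg) in
  Ask 0 (fun=> EvalGrad i x) (fun _ _ =>
  let ai := slot t.+3 in
  let v := w ++ lscale (ui - u i) ai in
  Ask 0 (fun=> ProxReg m (pos_of om)
    (lscale om ((lscale mu x ++ lscale (2 * mu * s) z) ++ lscale (-1) v)))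
    (fun _ _ => next (w ++ lscale (m%:R^-1 * (ui - u i)) ai) (update u i ui)))))).

Fixpoint coordinate_steps {B : Type} (T t : nat) (x z zm w : lincomb R)
    (u : 'I_m -> R) (next : nat -> lincomb R -> program B) : program B :=
  if T is T'.+1 then
    coordinate_step t x z zm w u (fun w' u' =>
      coordinate_steps T' t.+4.+1 x (slot t.+4) z w' u' next)
  else next t w.

(** What one stage passes to the next; [current] is the iterate, [kept] the
    point that the method holds. *)
Record iterate := Iterate {
  count : nat;
  memory_size : nat;
  current : lincomb R;
  kept : lincomb R
}.

(** The last operation draws [j] uniformly from [{0, ..., count c}] and makes
    the starting iterate of the stage the point held when [j] is 0; this keeps
    the point held uniformly distributed over all such iterates. *)
Definition stage (T : nat) (c : iterate) : program iterate :=
  let x := current c in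
  Ask 0 (fun=> ProxReg m (pos_of mu^-1) x) (fun _ _ =>
  let z := slot (memory_size c) in
  coordinate_steps T (memory_size c).+1 x z z [::] (fun=> 0) (fun t w =>
  Ask (count c) (fun=> ProxReg m (pos_of mu^-1) (x ++ lscale (- mu^-1) w)) (fun j _ =>
  Return (Iterate (count c).+1 t.+1 (slot t) (if j == 0%N then x else kept c))))).

Lemma performs_coordinate_steps B n T t x z zm w u (next : nat -> lincomb R -> program B) :
  (forall t w, performs n (next t w)) ->
  performs (5 * T + n) (coordinate_steps T t x z zm w u next).
Proof.
move=> H; elim: T t z zm w u => [|T IH] t z zm w u; first by rewrite muln0; exact: H.
rewrite mulnSr addnAC addnC; do 5 (apply: performs_ask => ? ?).
exact: IH.
Qed.

Lemma performs_stage T c : performs (5 * T).+2 (stage T c).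
Proof.
apply: performs_ask => _ _; rewrite -[(5 * T).+1]addn1.
by apply: performs_coordinate_steps => t w; apply: performs_ask.
Qed.

Context {d : nat} (P : problem R d m).
Local Notation g := (reg P).
Local Notation h := (outer P).
Local Notation c := (inner P).
Variables (L b G : R).
Hypothesis P_std : standing_assumptions P L b.
Hypothesis grad_bound :
  forall x, dom g x -> forall i, enorm (gradient (c i) x) <= G.
Hypothesis muE : mu = L * b.
Hypothesis mu0 : 0 < mu.
Hypothesis nu0 : 0 < nu.
Hypothesis s0 : 0 < s.
Hypothesis s_large : (m%:R : R) * G ^+ 2 <= mu * nu * s ^+ 2.
Hypothesis theta0 : 0 <= theta.
Hypothesis theta1 : theta <= 1.
Hypothesis theta_primal : mu * s <= theta * (mu + mu * s).
Hypothesis theta_dual :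
  nu + nu * s / m%:R - nu / m%:R <= theta * (nu + nu * s / m%:R).

Let g_pcc : proper_closed_convex g. Proof. by case: P_std. Qed.

Let h_convex i : real_convex (h i).
Proof.
case: P_std => _ hc _ _ _ r q t /andP[t0 t1].
have := hc i (Itv01 t0 t1) r q; rewrite !in_setT => /(_ isT isT).
by rewrite !convRE.
Qed.

Let h_lip i : real_lipschitz L (h i).
Proof. by case: P_std => _ _ hl _ _ r q; exact: (hl i (r, q)). Qed.

Section AtPoint.
Variable y : 'rV[R]_d.
Hypothesis dy : dom g y.
Local Notation a := (fun i => gradient (c i) y).
Local Notation b' := (fun i => c i y).

Let a_bound i : enorm (a i) <= G. Proof. exact: grad_bound. Qed.

Local Notation Phi := (lyapunov g h a b' y mu nu s).

(** The program computes the vectors and numbers of [dual_step] and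
    [primal_step]. *)
Lemma coordinate_step_expect B t M x z zm w u zv zmv wv
    (next : lincomb R -> ('I_m -> R) -> program B) f :
  size M = t -> denotes M x y -> denotes M z zv -> denotes M zm zmv ->
  denotes M w wv ->
  expect P (coordinate_step t x z zm w u next) M f =
  m%:R^-1 * \sum_i
    let ui := dual_step h a b' y nu s (zv + theta *: (zv - zmv)) u i in
    expect P
      (next (w ++ lscale (m%:R^-1 * (ui - u i)) (slot t.+3)) (update u i ui))
      (rcons (rcons (rcons (rcons (rcons M 0) 0) 0) (a i))
         (primal_step g y mu s zv (wv + (ui - u i) *: a i))) f.
Proof.
move=> sM Mx Mz Mzm Mw.
have mR0 : 0 < (m%:R : R) by rewrite ltr0n.
have sg0 : 0 < nu + 2 * nu * s / m%:R by rewrite addr_gt0 // divr_gt0 // !mulr_gt0.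
have t0 : 0 < (mu + 2 * mu * s)^-1 by rewrite invr_gt0 addr_gt0 // !mulr_gt0.
rewrite /coordinate_step expect_ask; congr (_ * _).
apply: eq_bigr => i _; rewrite inord_val !expect_ask0.
have -> : scalar_answer P M (EvalInner i x) = c i y by rewrite /= (denotes_eval Mx).
have -> : vector_answer P M (EvalInner i x) = 0 by [].
set o1 := EvalDot _ _ _.
have -> : vector_answer P (rcons M 0) o1 = 0 by [].
have -> : scalar_answer P (rcons M 0) o1 = dot (a i) (zv + theta *: (zv - zmv) - y).
  rewrite /o1 /=.
  set E := eval_lincomb (rcons M 0) x.
  have -> : E = y by exact/denotes_eval/denotes_rcons.
  congr dot; apply/denotes_eval/denotes_rcons.
  rewrite -(scaleN1r zmv) -(scaleN1r y); apply/denotes_cat/denotes_scale => //.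
  by apply/denotes_cat/denotes_scale/denotes_cat/denotes_scale.
set q := _ + _ * u i; set ui := _ / _; set o2 := ProxOuter _ _ _.
have -> : vector_answer P (rcons (rcons M 0) 0) o2 = 0 by [].
have -> : ui = dual_step h a b' y nu s (zv + theta *: (zv - zmv)) u i.
  by rewrite /ui /= pos_ofE.
move: (dual_step _ _ _ _ _ _ _ _ _) => c0 {q ui o2}.
set M3 := rcons (rcons (rcons M 0) 0) 0.
have den e v : denotes M e v -> denotes M3 e v.
  by move=> He; do 3 apply: denotes_rcons.
have -> : vector_answer P M3 (EvalGrad i x) = a i.
  by rewrite /vector_answer (denotes_eval (den _ _ Mx)).
set o3 := ProxReg _ _ _; set M4 := rcons M3 _.
suff -> : vector_answer P M4 o3 = primal_step g y mu s zv (wv + (c0 - u i) *: a i) by [].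
rewrite /o3 /vector_answer pos_ofE // /primal_step; congr prox.
have den4 e v : denotes M e v -> denotes M4 e v.
  by move=> He; apply: denotes_rcons; exact: den.
apply: denotes_eval; apply: denotes_scale; rewrite -(scaleN1r (wv + _)).
apply: denotes_cat; first by apply: denotes_cat; apply: denotes_scale; exact: den4.
apply: denotes_scale; apply: denotes_cat; first exact: den4.
by apply: denotes_scale; apply: denotes_slot; rewrite !size_rcons sM.
Qed.

(** Induction on the number of steps; what follows the steps enters only
    through a bound that is affine in [lyapunov]. *)
Lemma coordinate_steps_expect B T t M x z zm w u
    (next : nat -> lincomb R -> program B) f (A0 B0 : R) zv zmv :
  0 <= B0 -> size M = t -> denotes M x y -> denotes M z zv -> denotes M zm zmv ->
  denotes M w (mix a u) ->
  (forall t2 M2 w2 u2 z2 zm2, size M2 = t2 ->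
    (forall e v, denotes M e v -> denotes M2 e v) ->
    denotes M2 w2 (mix a u2) ->
    expect P (next t2 w2) M2 f <= A0 + B0 * Phi z2 zm2 u2) ->
  expect P (coordinate_steps T t x z zm w u next) M f
    <= A0 + B0 * theta ^+ T * Phi zv zmv u.
Proof.
move=> B00; elim: T t M z zm w u zv zmv => [|T IH] t M z zm w u zv zmv sM Mx Mz Mzm Mw leaf.
  by rewrite expr0 mulr1; exact: leaf.
have contr := coordinate_step_contracts b' y (ltn0Sn m') g_pcc h_convex h_lip
  a_bound mu0 nu0 s0 s_large theta0 theta1 theta_primal theta_dual zv zmv u.
apply: (@le_trans _ _ (A0 + B0 * theta ^+ T * (theta * Phi zv zmv u))); last first.
  by rewrite exprSr !mulrA.
apply: le_trans (lerD (lexx A0) (ler_wpM2l (mulr_ge0 B00 (exprn_ge0 T theta0)) contr)).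
rewrite [X in _ <= _ + X]mulrCA.
rewrite -[A0 in leRHS](mean_const (ltn0Sn m')) -mulrDr.
rewrite [coordinate_steps _ _ _ _ _ _ _ _]/=.
rewrite (coordinate_step_expect _ _ _ sM Mx Mz Mzm Mw).
rewrite ler_pM2l ?invr_gt0 ?ltr0n // mulr_sumr -big_split.
apply: ler_sum => i _; rewrite [leRHS]/=; cbv zeta.
set c0 := dual_step _ _ _ _ _ _ _ _ _.
set M' := rcons _ _.
have den e v : denotes M e v -> denotes M' e v.
  by move=> He; do 5 apply: denotes_rcons.
apply: IH.
- by rewrite !size_rcons sM.
- exact: den.
- by apply: denotes_slot; rewrite !size_rcons sM.
- exact: den.
- rewrite mix_update; apply: denotes_cat; first exact: den.
  apply: denotes_scale; apply: denotes_rcons; apply: denotes_slot.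
  by rewrite !size_rcons sM.
- by move=> t2 M2 w2 u2 z2 zm2 sM2 den2 Mw2; apply: leaf => // e v He; exact/den2/den.
Qed.

Local Notation model_value := (penalized g a b' y mu h).
Local Notation phi x := (enorm (prox_gradient P mu^-1 x) ^+ 2).

Definition value x := mean_outer P (fun i => c i x) + fine (g x).

(** The error of each linearization is at most [b / 2 |z - y|^2], and [h i]
    multiplies it by at most [L]. *)
Lemma value_le_model z : dom g z -> value z <= model_value z.
Proof.
move=> dz; suff : mean_outer P (fun i => c i z)
    <= average a b' y h z + mu / 2 * enorm (z - y) ^+ 2.
  by rewrite /value /penalized; lra.
rewrite /average /mean_outer; have mR0 : 0 < (m%:R : R) by rewrite ltr0n.
have L0 : 0 <= L := lip_const_ge0 (h_lip ord0).
rewrite -[X in _ + X](mean_const (ltn0Sn m')) -mulrDr ler_pM2l ?invr_gt0 //.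
rewrite -big_split; apply: ler_sum => i _ /=.
have := le_trans (ler_norm _) (h_lip i (c i z) (affine a b' y i z)).
have [smooth _] := inner_C1 P_std i.
have := descent_lemma y z smooth (inner_lipschitz P_std i).
rewrite -/(affine a b' y i z) => /(ler_wpM2l L0); rewrite muE; lra.
Qed.

Lemma value_model : value y = model_value y.
Proof.
rewrite /value /penalized enorm_sqr subrr dot0l mulr0 addr0 addrC.
congr (_ + _); rewrite /average /mean_outer; congr (_ * _).
by apply: eq_bigr => i _; rewrite /affine subrr dotC dot0l addr0.
Qed.

(** Strong convexity of the model, whose value at [y] is that of the objective,
    in terms of the prox-gradient. *)
Lemma prox_linear_min : exists2 S, dom g S &
  phi y + 2 * mu * model_value S <= 2 * mu * value y.
Proof.
have [] := penalized_argmin b' y (ltn0Sn m') g_pcc a_bound mu0 h_convex h_lip.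
set S := the_argmin _ => dS /(_ y dy).
have SE : prox_linear_step P mu^-1 y = S.
  rewrite /prox_linear_step /S; congr the_argmin; apply/funext => z.
  by rewrite /model -addeA -EFinD invfM invrK (mulrC 2^-1).
rewrite -value_model => hS; exists S => //.
rewrite /prox_gradient SE invrK enormZ exprMn gtr0_norm //.
have -> : mu ^+ 2 * enorm (y - S) ^+ 2 = 2 * mu * (mu / 2 * enorm (y - S) ^+ 2).
  by field.
by rewrite -mulrDr ler_pM2l ?mulr_gt0 // addrC.
Qed.

(** A bound on the expected model gap after [T] coordinate steps: smoothing,
    the splitting parameter, and what remains of the initial [lyapunov]. *)
Definition stage_error (eta : R) (T : nat) :=
  L ^+ 2 * nu / 2 + eta / mu
  + (1 + (L * G) ^+ 2 / eta) * (2 * G ^+ 2) / (mu * nu * (m%:R + s)) * theta ^+ T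
    * ((1 + s) * (L ^+ 2 * G ^+ 2) / mu + nu * (m%:R + s) * L ^+ 2).

(** In expectation over the final draw, [count * |p(kept)|^2] grows by
    [|p(y)|^2], where [p] is the prox-gradient; the decrease of [2 mu F] pays
    for this up to the gap of the new iterate. *)
Lemma stage_expect eta T M st o f c0 : 0 < eta ->
  size M = memory_size st -> denotes M (current st) y -> denotes M (kept st) o ->
  (forall M' st' x' o', count st' = (count st).+1 -> size M' = memory_size st' ->
    denotes M' (current st') x' -> dom g x' -> denotes M' (kept st') o' ->
    f st' M' <= (count st')%:R * phi o' + 2 * mu * value x' + c0) ->
  expect P (stage T st) M f <=
    (count st)%:R * phi o + 2 * mu * value y + 2 * mu * stage_error eta T + c0.
Proof.
move=> eta0 sM My Mo Hf.
have arith (p q v S1 zv c1 KL cc : R) : p + 2 * mu * S1 <= 2 * mu * v ->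
    2 * mu * zv <= 2 * mu * (S1 + (c1 + KL)) ->
    p + q + (2 * mu * zv + cc) <= q + 2 * mu * v + cc + 2 * mu * c1 + 2 * mu * KL.
  by move=> ? ?; lra.
have mR0 : 0 < (m%:R : R) by rewrite ltr0n.
have mi0 : 0 < mu^-1 by rewrite invr_gt0.
have ms0 : 0 < m%:R + s by exact: addr_gt0.
have [S dS hS] := prox_linear_min.
set K := (1 + (L * G) ^+ 2 / eta) * (2 * G ^+ 2) / (mu * nu * (m%:R + s)).
have K0 : 0 <= K.
  apply: divr_ge0; last by apply: ltW; rewrite !mulr_gt0.
  apply: mulr_ge0; last by rewrite mulr_ge0 ?sqr_ge0.
  by rewrite addr_ge0 // divr_ge0 ?sqr_ge0 // ltW.
pose A0 := (count st)%:R * phi o + 2 * mu * value y + c0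
  + 2 * mu * (L ^+ 2 * nu / 2 + eta / mu).
have m20 : 0 <= 2 * mu by rewrite mulr_ge0 // ltW.
have K2 : 0 <= 2 * mu * K by exact: mulr_ge0.
apply: (@le_trans _ _ (A0 + 2 * mu * K * theta ^+ T
    * Phi (primal_of g y mu 0) (primal_of g y mu 0) (fun=> 0))); last first.
  have := lyapunov_start b' y (ltn0Sn m') g_pcc h_convex h_lip a_bound mu0 nu0 s0.
  set Y := Phi _ _ _; set X := (rhs in _ <= rhs) => YX.
  have -> : stage_error eta T = L ^+ 2 * nu / 2 + eta / mu + K * theta ^+ T * X by [].
  have := ler_wpM2l (mulr_ge0 K2 (exprn_ge0 T theta0)) YX.
  rewrite /A0; move: (L ^+ 2 * nu / 2 + eta / mu) (theta ^+ T) (_ * phi o) (value y) => e1 q e2 e3.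
  clearbody K X Y; lra.
rewrite /stage expect_ask0.
have -> : vector_answer P M (ProxReg m (pos_of mu^-1) (current st)) = primal_of g y mu 0.
  by rewrite /vector_answer (denotes_eval My) pos_ofE // /primal_of scaler0 subr0.
set M1 := rcons M _.
have den1 e v : denotes M e v -> denotes M1 e v by exact: denotes_rcons.
refine (@coordinate_steps_expect iterate T (memory_size st).+1 M1 (current st)
  _ _ [::] (fun=> 0) _ f A0 (2 * mu * K) _ _ K2 _ _ _ _ _ _).
- by rewrite size_rcons sM.
- exact: den1.
- exact: denotes_slot.
- exact: denotes_slot.
- have -> : mix a (fun=> 0) = 0; last exact: denotes_nil.
  by rewrite /mix big1 ?scaler0 // => i _; rewrite scale0r.
move=> t2 M2 w2 u2 z2 zm2 sM2 den2 Mw2.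
rewrite expect_ask.
set z := primal_of g y mu (mix a u2).
have -> : vector_answer P M2 (ProxReg m (pos_of mu^-1) (current st ++ lscale (- mu^-1) w2)) = z.
  rewrite /vector_answer pos_ofE // /z /primal_of; congr prox.
  rewrite -scaleNr; apply/denotes_eval/denotes_cat/denotes_scale => //.
  exact/den2/den1.
have [dz _] := primal_of_subgradient y g_pcc mu0 (mix a u2).
rewrite -/z in dz.
have gap := primal_of_mix_gap b' y (ltn0Sn m') g_pcc h_convex h_lip a_bound mu0 nu0
  s0 s_large z2 zm2 u2 eta0 dS.
rewrite -/z -/K in gap.
pose E := 2 * mu * value z + c0.
apply: (@le_trans _ _ ((count st).+1%:R^-1 * \sum_(j < (count st).+1)
    ((count st).+1%:R * phi (if j == 0%N :> nat then y else o) + E))).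
  rewrite ler_pM2l ?invr_gt0 ?ltr0n //; apply: ler_sum => j _ /=.
  rewrite /E addrA; apply: (Hf _ (Iterate _ _ _ _)) => //=.
  - by rewrite size_rcons sM2.
  - exact: denotes_slot.
  - by case: ifP => _; apply: denotes_rcons; apply: den2; exact: den1.
rewrite big_split /= mulrDr mean_const // -mulr_sumr mulKf ?pnatr_eq0 //.
rewrite big_ord_recl /= sumr_const card_ord -[phi o *+ _]mulr_natl.
have hz := ler_wpM2l m20 (le_trans (value_le_model dz) gap).
by rewrite -[X in _ <= _ + X]mulrA; exact: arith hS hz.
Qed.

End AtPoint.

Local Notation phi x := (enorm (prox_gradient P mu^-1 x) ^+ 2).

(** The supermartingale argument; the offset [r] lets the method be stopped
    inside a stage. *)
Lemma stages_expectation eta T I st0 j r st M y o :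
  0 < eta -> (forall x, dom g x -> I <= value x) -> (r < (5 * T).+2)%N ->
  size M = memory_size st -> denotes M (current st) y -> dom g y ->
  denotes M (kept st) o ->
  (count st + j)%:R *
    expectation_from P (A := repeat_method (stage T) kept st0) (fun x => phi x)
      (j * (5 * T).+2 + r) (kept st, stage T st) M
  <= (count st)%:R * phi o + 2 * mu * (value y - I)
     + 2 * mu * stage_error eta T *+ j.
Proof.
move=> eta0 HI rT; have m20 : 0 <= 2 * mu by rewrite mulr_ge0 // ltW.
elim: j st M y o => [|j IH] st M y o sM My dy Mo.
  rewrite addn0 mul0n add0n mulr0n addr0.
  rewrite (expectation_mid_stage _ _ _ P _ (performs_stage T st) rT Mo) lerDl.
  by rewrite mulr_ge0 // subr_ge0 HI.
rewrite mulSn -addnA (expectation_stage _ _ _ P _ _ _ _ (performs_stage T st)) expect_scale.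
apply: (le_trans (@stage_expect y dy eta T M st o _
   (2 * mu * stage_error eta T *+ j - 2 * mu * I) eta0 sM My Mo _)); last first.
  by rewrite mulrS mulrBr; lra.
move=> M' st' x' o' ct sM' Mx' dx' Mo'.
have := IH st' M' x' o' sM' Mx' dx' Mo'; rewrite {1}ct addSnnS mulrBr; lra.
Qed.

End StageProgram.

(** * Parameters and complexity *)

Section MethodParameters.
Set Implicit Arguments. Unset Strict Implicit. Unset Printing Implicit Defensive.
Context {R : realType}.
Implicit Types (L b G e : R).

(** The parameter [nu]; smoothing then costs [L^2 nu / 2 = e^2 / (8 mu)], half
    of the accuracy [e^2 / (4 mu)] of a stage. *)
Definition smoothing L b e : R := e ^+ 2 / (4 * (L * b) * L ^+ 2).
(** The number [s]: [sqrt m] times [G / sqrt (mu nu)], which is the square root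
    of the condition number of one smoothed term and equals [2 L G / e]. *)
Definition condition_number (m : nat) L G e : R :=
  2 * Num.sqrt m%:R * (L * G / e).
Definition contraction (m : nat) L G e : R :=
  1 - (m%:R + condition_number m L G e)^-1.
Definition inner_steps (m : nat) L G e : nat :=
  (Num.trunc (7 * (m%:R + condition_number m L G e) * ln (L * G / e))).+1.

Definition prox_linear_method (m : nat) L b G e : method R m :=
  if m is m'.+1 then
    repeat_method
      (stage (m' := m') (L * b) (smoothing L b e) (condition_number m L G e)
         (contraction m L G e) (inner_steps m L G e))
      (@kept R) (Iterate 0 1 (slot 0) (slot 0))
  else repeat_method (@Return R 0 (lincomb R)) id [::].

Variables (m' : nat) (L b G e : R).
Local Notation m := m'.+1.
Hypotheses (L20 : 20 <= L) (b20 : 20 <= b) (G20 : 20 <= G) (e20 : 20 <= e^-1).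
Hypothesis e0 : 0 < e.

Local Notation k := (L * G / e).
Local Notation mu := (L * b).
Local Notation s := (condition_number m L G e).
Local Notation theta := (contraction m L G e).
Local Notation nu := (smoothing L b e).

Let L0 : 0 < L. Proof. exact: lt_le_trans L20. Qed.
Let b0 : 0 < b. Proof. exact: lt_le_trans b20. Qed.
Let G0 : 0 < G. Proof. exact: lt_le_trans G20. Qed.
Let mu0 : 0 < mu. Proof. exact: mulr_gt0. Qed.

Let m1 : 1 <= m%:R :> R. Proof. by rewrite ler1n. Qed.

Let sqrtm1 : 1 <= Num.sqrt m%:R :> R.
Proof. by rewrite -[leLHS]sqrtr1 ler_wsqrtr ?ler1n. Qed.

Lemma ratio_large : 20 * 20 * 20 <= k.
Proof.
apply: ler_pM => //.
by apply: ler_pM.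
Qed.

Let k0 : 0 < k. Proof. by apply: lt_le_trans ratio_large; rewrite !mulr_gt0. Qed.

Lemma ln_ratio_ge : 1 / 2 <= ln k.
Proof.
have := expR_ge1Dx (- ln k); rewrite expRN lnK ?posrE //.
have : k^-1 <= 2^-1 by rewrite lef_pV2 ?posrE //; have := ratio_large; lra.
lra.
Qed.

Lemma condition_number_ge : 2 <= s.
Proof.
have := ratio_large; have := sqrtm1.
rewrite /condition_number; move: (Num.sqrt _) k => q r; nra.
Qed.

Let s0 : 0 < s. Proof. exact: lt_le_trans condition_number_ge. Qed.

Let ms0 : 0 < m%:R + s. Proof. by rewrite addr_gt0 // ltr0n. Qed.

Lemma smoothing_gt0 : 0 < nu.
Proof. by rewrite divr_gt0 ?exprn_gt0 // !mulr_gt0 ?exprn_gt0. Qed.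

Lemma mu_smoothing : mu * nu = e ^+ 2 / (4 * L ^+ 2).
Proof. by rewrite /smoothing; field; rewrite !gt_eqF. Qed.

Lemma condition_number_large : m%:R * G ^+ 2 <= mu * nu * s ^+ 2.
Proof.
rewrite mu_smoothing /condition_number !exprMn sqr_sqrtr ?ler0n //.
by rewrite le_eqVlt; apply/orP; left; apply/eqP; field; rewrite !gt_eqF.
Qed.

Let inv_le1 : (m%:R + s)^-1 <= 1.
Proof. by rewrite invf_le1 //; have := m1; have := s0; lra. Qed.

Lemma contraction_ge0 : 0 <= theta. Proof. by rewrite subr_ge0. Qed.

Lemma contraction_le1 : theta <= 1.
Proof. by rewrite gerBl invr_ge0 ltW. Qed.

Lemma contraction_primal : mu * s <= theta * (mu + mu * s).
Proof.
have : (m%:R + s)^-1 * (1 + s) <= 1.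
  by rewrite ler_pdivrMl // mulr1 lerD2r.
move=> /(ler_wpM2l (ltW mu0)); rewrite /contraction; lra.
Qed.

Lemma contraction_dual :
  nu + nu * s / m%:R - nu / m%:R <= theta * (nu + nu * s / m%:R).
Proof.
have mR0 : 0 < m%:R :> R by rewrite ltr0n.
suff : (m%:R + s)^-1 * (nu + nu * s / m%:R) = nu / m%:R.
  by move=> h; rewrite /contraction mulrBl mul1r h.
have -> : nu + nu * s / m%:R = (m%:R + s) * (nu / m%:R) by field; rewrite gt_eqF.
by rewrite mulKf // gt_eqF.
Qed.

(** [1 - x <= exp (- x)], and the number of steps is at least [7 (m + s) ln k].
    *)
Lemma contraction_power : theta ^+ inner_steps m L G e <= k ^- 7.
Proof.
set T := inner_steps _ _ _ _.
have h1 : theta <= expR (- (m%:R + s)^-1) by exact: expR_ge1Dx.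
apply: (@le_trans _ _ (expR (- (m%:R + s)^-1) ^+ T)).
  by rewrite lerXn2r ?nnegrE ?expR_ge0 ?contraction_ge0.
rewrite -expRM_natr -[k in leRHS](lnK (x := k)) ?posrE // -expRM_natl -expRN ler_expR.
rewrite mulNr lerN2 ler_pdivlMl // mulrA (mulrC _ 7).
by apply: ltW; exact: truncnS_gt.
Qed.

(** The three parts of [stage_error] are [e^2 / (8 mu)], [e^2 / (16 mu)] and at
    most [e^2 / (16 mu)]; for the last one, the initial [lyapunov] and its
    coefficient contribute at most [32 * 85 * k^6] in the unit [e^2 / (16 mu)],
    and [32 * 85 <= k]. *)
Lemma stage_error_le : stage_error (m' := m') mu nu s theta L G (e ^+ 2 / 16)
  (inner_steps m L G e) <= e ^+ 2 / (4 * mu).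
Proof.
have n0 := smoothing_gt0.
rewrite /stage_error; set q := theta ^+ _.
have q7 : q <= k ^- 7 := contraction_power.
have q0 : 0 <= q by exact/exprn_ge0/contraction_ge0.
set c1 := (1 + _) * _ / _; set c2 := _ + nu * _ * _.
have c2le : c2 <= (m%:R + s) * (L ^+ 2 * G ^+ 2 / mu + nu * L ^+ 2).
  rewrite /c2.
  have -> : (m%:R + s) * (L ^+ 2 * G ^+ 2 / mu + nu * L ^+ 2)
    = (m%:R + s) * (L ^+ 2 * G ^+ 2) / mu + nu * (m%:R + s) * L ^+ 2 by ring.
  rewrite lerD2r; apply: ler_wpM2r; first by rewrite invr_ge0 ltW.
  by apply: ler_wpM2r; rewrite ?lerD2r // mulr_ge0 ?sqr_ge0.
have c10 : 0 <= c1.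
  apply: divr_ge0; last exact: ltW (mulr_gt0 (mulr_gt0 mu0 n0) ms0).
  apply: mulr_ge0; last by rewrite mulr_ge0 ?sqr_ge0.
  by apply: addr_ge0 => //; do 2?apply: divr_ge0; rewrite ?sqr_ge0.
suff main : c1 * q * c2 <= e ^+ 2 / (16 * mu).
  have e1 : L ^+ 2 * nu / 2 = e ^+ 2 / (8 * mu).
    by rewrite /smoothing; field; rewrite !gt_eqF.
  have e2 : e ^+ 2 / 16 / mu = e ^+ 2 / (16 * mu) by field; rewrite !gt_eqF.
  have e3 : e ^+ 2 / (4 * mu) = e ^+ 2 / (8 * mu) + e ^+ 2 / (16 * mu) + e ^+ 2 / (16 * mu).
    by field; rewrite !gt_eqF.
  by rewrite e1 e2 e3 lerD2l.
apply: (le_trans (ler_wpM2l (mulr_ge0 c10 q0) c2le)).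
have -> : c1 * q * ((m%:R + s) * (L ^+ 2 * G ^+ 2 / mu + nu * L ^+ 2))
  = e ^+ 2 / (16 * mu) * (32 * k ^+ 2 * (1 + 16 * k ^+ 2) * (1 + 4 * k ^+ 2) * q).
  rewrite /c1 mu_smoothing /smoothing; move: (m%:R + s) ms0 => w w0.
  by field; rewrite !gt_eqF.
rewrite ger_pMr; last by rewrite divr_gt0 ?exprn_gt0 // mulr_gt0.
set p := 32 * _ * _ * _.
have p0 : 0 <= p.
  by rewrite /p; move: (k ^+ 2) (sqr_ge0 k) => X X0; rewrite !mulr_ge0 ?addr_ge0 ?mulr_ge0.
apply: (le_trans (ler_wpM2l p0 q7)); rewrite ler_pdivrMr ?exprn_gt0 // mul1r.
have k1 := ratio_large.
have k2 : 1 <= k ^+ 2 by rewrite exprn_ege1 //; lra.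
apply: (@le_trans _ _ (k ^+ 2 * k ^+ 2 * k ^+ 2 * (32 * 85))).
  rewrite /p; move: (k ^+ 2) k2 => X X1.
  have h1 : (1 + 16 * X) * (1 + 4 * X) <= 85 * X ^+ 2 by rewrite expr2; nra.
  have X0 : 0 <= 32 * X by lra.
  by have := ler_wpM2l X0 h1; rewrite expr2; lra.
have -> : k ^+ 2 * k ^+ 2 * k ^+ 2 = k ^+ 6 by rewrite -!exprD.
by rewrite (exprSr k 6) ler_wpM2l ?exprn_ge0 ?(ltW k0) //; lra.
Qed.

(** If [k < sqrt m], then [sqrt m * k] is dominated by [m]; otherwise it is the
    second term of the bound. *)
Lemma stage_cost_le :
  ((5 * inner_steps m L G e).+2)%:R <=
  126 * (m%:R + k * Num.min (Num.sqrt m%:R) k) * ln k.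
Proof.
have l2 := ln_ratio_ge; have s16 := condition_number_ge.
have msl : 1 <= (m%:R + s) * ln k.
  have h2 : 2 <= m%:R + s by have := m1; lra.
  by apply: le_trans (ler_pM _ _ h2 l2); lra.
have T_le : (inner_steps m L G e)%:R <= 7 * (m%:R + s) * ln k + 1.
  rewrite /inner_steps -natr1 lerD2r truncn_le //.
  by rewrite !mulr_ge0 ?(ltW ms0) //; lra.
have -> : ((5 * inner_steps m L G e).+2)%:R = 5 * (inner_steps m L G e)%:R + 2 :> R.
  by rewrite -addn2 natrD natrM.
have step1 : 5 * (inner_steps m L G e)%:R + 2 <= 42 * ((m%:R + s) * ln k) by lra.
apply: le_trans step1 _.
have -> : 126 * (m%:R + k * Num.min (Num.sqrt m%:R) k) * ln k
   = 42 * (3 * (m%:R + k * Num.min (Num.sqrt m%:R) k) * ln k) by ring.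
rewrite ler_pM2l // ler_wpM2r //; first by lra.
have q2 : Num.sqrt m%:R ^+ 2 = m%:R :> R by rewrite sqr_sqrtr.
rewrite /condition_number; move: (Num.sqrt _) k q2 sqrtm1 k0 => q r <- q1 r0.
have h1 := mulr_ge0 (le_trans ler01 q1) (ltW r0).
have := sqr_ge0 (q - r); rewrite sqrrB !expr2 => h2.
have := sqr_ge0 q; have := sqr_ge0 r; rewrite !expr2 => r2 q2.
by case: (leP q r) => qr; lra.
Qed.

End MethodParameters.

Section ObjectiveValue.
Set Implicit Arguments. Unset Strict Implicit. Unset Printing Implicit Defensive.
Context {R : realType} {d m' : nat}.
Local Notation m := m'.+1.
Variables (P : problem R d m) (L b : R).
Hypothesis P_std : standing_assumptions P L b.

Lemma objective_value x : dom (reg P) x -> objective P x = (value P x)%:E.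
Proof.
move=> dx; case: P_std => g_pcc _ _ _ _.
by rewrite /objective (dom_fin_num g_pcc dx) -EFinD.
Qed.

End ObjectiveValue.

(* The method does not know [F(x0) - inf F], hence cannot tell by itself when to
   stop: the point that it holds satisfies the estimate after [N] basic
   operations and whenever it is stopped later. *)
Theorem mainTheorem6 (R : realType) :
  exists (K C : R) (A : forall m : nat, R -> R -> R -> R -> method R m),
    0 < K /\ 0 < C /\
    forall (d m : nat) (P : problem R d m) (L b G e : R) (x0 : 'rV[R]_d),
      (0 < m)%N ->
      standing_assumptions P L b ->
      (forall x, dom (reg P) x -> forall i, enorm (gradient (inner P i) x) <= G) ->
      dom (reg P) x0 ->
      0 < e ->
      (-oo < inf_objective P)%E ->
      K <= G -> K <= L -> K <= b ->
      (K%:E <= objective P x0 - inf_objective P)%E ->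
      K <= e^-1 ->
      exists N : nat,
        N%:R <= C * (L * b * m%:R / e ^+ 2
                     + L ^+ 2 * b * G / e ^+ 3
                       * Num.min (Num.sqrt m%:R) (L * G / e))
                  * fine (objective P x0 - inf_objective P)%E
                  * ln (L * G / e) /\
        forall n : nat, (N <= n)%N ->
          expectation_after P (A m L b G e) n x0
            (fun x => enorm (prox_gradient P (L * b)^-1 x) ^+ 2) <= e ^+ 2.
Proof.
exists 20, (5 * 126), (@prox_linear_method R); split; first by rewrite ltr0n.
split; first by rewrite mulr_gt0 ?ltr0n.
move=> d [//|m'] P L b G e x0 _ P_std grad_bound dx0 e0 infP G20 L20 b20 D20 e20.
have L0 : 0 < L by exact: lt_le_trans L20.
have b0 : 0 < b by exact: lt_le_trans b20.
have mu0 : 0 < L * b by exact: mulr_gt0.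
have ei : e^-1 * e = 1 by rewrite mulVf ?gt_eqF.
pose m := m'.+1; pose T := inner_steps m L G e; pose l := (5 * T).+2.
pose k := L * G / e; pose mu := L * b.
have inf_le x : dom (reg P) x -> (inf_objective P <= (value P x)%:E)%E.
  by move=> dx; rewrite -(objective_value P_std dx); apply: ereal_inf_lbound; exists x.
pose I := fine (inf_objective P).
have IE : inf_objective P = I%:E.
  rewrite /I fineK // fin_numE gt_eqF //= lt_eqF //.
  by apply: le_lt_trans (inf_le _ dx0) _; rewrite ltry.
have I_le x : dom (reg P) x -> I <= value P x.
  by move=> /inf_le; rewrite IE lee_fin.
rewrite (objective_value P_std dx0) IE -EFinB [fine _]/=.
move: D20; rewrite (objective_value P_std dx0) IE -EFinB lee_fin.
set D := value P x0 - I => D20.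
(* [S] stages make the contribution of the initial gap at most [e^2 / 2]. *)
pose S := 4 * mu * D / e ^+ 2.
exists ((Num.trunc S).+1 * l)%N; split.
  have cost := stage_cost_le m' L20 G20 e20.
  have e2 : 0 < e ^+ 2 by exact: exprn_gt0.
  have S_le : (Num.trunc S).+1%:R <= 5 * mu * D / e ^+ 2.
    have S1 : 1 <= mu * D / e ^+ 2.
      have mu1 : 1 <= mu by rewrite /mu; nra.
      have e1 : e ^+ 2 <= 1 by rewrite expr2; nra.
      by rewrite ler_pdivlMr // mul1r (le_trans e1) //; nra.
    have S0 : 0 <= S by rewrite /S -mulrA -mulrA mulr_ge0 // mulrA; lra.
    have : (Num.trunc S)%:R <= S by rewrite truncn_le.
    rewrite -natr1 => h; apply: (le_trans (lerD h S1)).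
    by rewrite /S; lra.
  rewrite natrM; apply: (le_trans (ler_pM (ler0n _ _) (ler0n _ _) S_le cost)).
  rewrite le_eqVlt; apply/orP; left; apply/eqP.
  move: (Num.min _ _) (ln _) => w z; rewrite /mu.
  by field; rewrite gt_eqF.
move=> n nN.
pose j := (n %/ l)%N.
have l0 : (0 < l)%N by [].
have jS : S < j%:R.
  apply: lt_le_trans (truncnS_gt S) _; rewrite ler_nat.
  by rewrite leq_divRL.
have eta0 : 0 < e ^+ 2 / 16 by rewrite divr_gt0 ?exprn_gt0.
have nu0 := smoothing_gt0 L20 b20 e0.
have s0 : 0 < condition_number m L G e.
  by apply: lt_le_trans (condition_number_ge m' L20 G20 e20).
have slot0 : denotes [:: x0] (slot 0) x0 by exact: (denotes_slot (M := [::])).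
have sl : m%:R * G ^+ 2 <= mu * smoothing L b e * condition_number m L G e ^+ 2.
  exact: condition_number_large.
have th0 : 0 <= contraction m L G e by exact: contraction_ge0.
have th1 : contraction m L G e <= 1 by exact: contraction_le1.
have := @stages_expectation R m' mu _ _ _ d P L b G P_std grad_bound erefl mu0 nu0 s0
  sl th0 th1 (contraction_primal m' L20 b20 G20 e20)
  (contraction_dual m' b L20 G20 e20) (e ^+ 2 / 16) T I (Iterate 0 1 (slot 0) (slot 0)) j (n %% l)
  (Iterate 0 1 (slot 0) (slot 0)) [:: x0] x0 x0 eta0 I_le (ltn_pmod n l0) erefl slot0 dx0 slot0.
have err := stage_error_le m' L20 b20 G20 e20 e0.
rewrite -/m -/mu -/T -/l in err *.
rewrite -(divn_eq n l) [count _]/= add0n mul0r add0r -/D.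
rewrite -[expectation_from _ _ _ _ _]/(expectation_after P (prox_linear_method m L b G e) n x0
  (fun x => enorm (prox_gradient P mu^-1 x) ^+ 2)).
set X := expectation_after _ _ _ _ _.
set err' := stage_error _ _ _ _ _ _ _ _ in err *.
rewrite -[2 * mu * err' *+ j]mulr_natl => main.
have j0 : 0 < j%:R :> R.
  by apply: le_lt_trans jS; rewrite /S !mulr_ge0 ?invr_ge0 ?sqr_ge0 // ltW // (lt_le_trans _ D20).
rewrite -(ler_pM2l j0); apply: (le_trans main).
have h1 : 2 * mu * D <= j%:R * (e ^+ 2 / 2).
  have -> : 2 * mu * D = S * (e ^+ 2 / 2) by rewrite /S; field; rewrite gt_eqF.
  by rewrite ler_wpM2r ?(ltW jS) // divr_ge0 ?sqr_ge0.
have m20 : 0 <= 2 * mu by rewrite mulr_ge0 // ltW.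
have h2 := ler_wpM2l m20 err.
have e4 : 2 * mu * (e ^+ 2 / (4 * mu)) = e ^+ 2 / 2.
  by rewrite /mu; field; rewrite !gt_eqF.
rewrite e4 in h2; have h3 := ler_wpM2l (ltW j0) h2.
have -> : j%:R * e ^+ 2 = j%:R * (e ^+ 2 / 2) + j%:R * (e ^+ 2 / 2) by field.
exact: lerD.
Qed.
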